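(* Let $\bar{\mathcal Q}$ and $\bar{\mathcal R}$ denote the results computed in floating-point arithmetic by any one of the algorithms BCGSI+A-3S, BCGSI+A-2S, or BCGSI+A-1S with block size $s=1$, applied to $\mathcal X\in\mathbb R^{m\times p}$. If $O(\varepsilon)\,\kappa(\mathcal X)\le\frac12$ is satisfied, then $$\mathcal X+\Delta\mathcal X=\bar{\mathcal Q}\bar{\mathcal R},\quad\|\Delta\mathcal X\|\le O(\varepsilon)\|\mathcal X\|,$$ and $$\|I-\bar{\mathcal Q}^T\bar{\mathcal Q}\|\le O(\varepsilon).$$
   Context: Conventions. $m\ge p$ are positive integers; $\mathcal X=[X_1\ \cdots\ X_p]\in\mathbb R^{m\times p}$ with columns $X_k\in\mathbb R^m$ (block size $s=1$). $\|\cdot\|$ is the induced 2-norm and $\kappa(\cdot)$ the 2-norm condition number (ratio of largest to smallest singular value). Computations are carried out in floating-point arithmetic (standard model) with unit roundoff $\varepsilon$, and bars denote computed quantities; batching matrix products is assumed to introduce only $O(\varepsilon)$ errors, as for ordinary matrix products. $O(\varepsilon)$ denotes a quantity bounded by $c\,\varepsilon$, where $c$ depends only on the dimensions $m,p$ and may differ at each occurrence; a hypothesis involving $O(\varepsilon)$ means that it holds with a suitable (sufficiently large) such constant. For $s=1$ the intraorthogonalization routines $\mathrm{IO}_A$ and $\mathrm{IO}$ reduce to scaling a column vector by its norm: $[q,r]=\mathrm{IO}(x)$ with $r=\|x\|$, $q=x/r$. $\mathrm{chol}(a)=\sqrt a$ for scalars. Notation. $\mathcal Q_k=[Q_1\ \cdots\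 Q_k]$; $\mathcal R=(R_{ij})$, $\mathcal S=(S_{ij})$, $\mathcal Y=(Y_{ij})$ are $p\times p$; a subscript $1{:}j,k$ denotes rows $1,\dots,j$ of column $k$. BCGSI+A-3S: $[Q_1,R_{11}]=\mathrm{IO}_A(X_1)$. For $k=2,\dots,p$: $\mathcal S_{1:k-1,k}=\mathcal Q_{k-1}^TX_k$; $V_k=X_k-\mathcal Q_{k-1}\mathcal S_{1:k-1,k}$; $\mathcal Y_{1:k-1,k}=\mathcal Q_{k-1}^TV_k$; $[Q_k,Y_{kk}]=\mathrm{IO}(V_k-\mathcal Q_{k-1}\mathcal Y_{1:k-1,k})$; $\mathcal R_{1:k-1,k}=\mathcal S_{1:k-1,k}+\mathcal Y_{1:k-1,k}$; $R_{kk}=Y_{kk}$. BCGSI+A-2S: as BCGSI+A-3S, except that in each iteration the computation of $\mathcal Y_{1:k-1,k}$ and the call to $\mathrm{IO}$ are replaced by: $\begin{bmatrix}\mathcal Y_{1:k-1,k}\\ \Omega_k\end{bmatrix}=[\mathcal Q_{k-1}\ V_k]^TV_k$; $Y_{kk}=\mathrm{chol}(\Omega_k-\mathcal Y_{1:k-1,k}^T\mathcal Y_{1:k-1,k})$; $Q_k=(V_k-\mathcal Q_{k-1}\mathcal Y_{1:k-1,k})Y_{kk}^{-1}$. BCGSI+A-1S: $[Q_1,R_{11}]=\mathrm{IO}_A(X_1)$; $S_{12}=Q_1^TX_2$; $V_2=X_2-Q_1S_{12}$. For $k=2,\dots,p-1$: $\begin{bmatrix}\mathcal Y_{1:k-1,k}&Z_{k-1}\\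 \Omega_k&P_k\end{bmatrix}=[\mathcal Q_{k-1}\ V_k]^T[V_k\ X_{k+1}]$; $Y_{kk}=\mathrm{chol}(\Omega_k-\mathcal Y_{1:k-1,k}^T\mathcal Y_{1:k-1,k})$; $Q_k=(V_k-\mathcal Q_{k-1}\mathcal Y_{1:k-1,k})Y_{kk}^{-1}$; $\mathcal R_{1:k-1,k}=\mathcal S_{1:k-1,k}+\mathcal Y_{1:k-1,k}$; $R_{kk}=Y_{kk}$; $\mathcal S_{1:k,k+1}=\begin{bmatrix}Z_{k-1}\\ Y_{kk}^{-T}(P_k-\mathcal Y_{1:k-1,k}^TZ_{k-1})\end{bmatrix}$; $V_{k+1}=X_{k+1}-\mathcal Q_k\mathcal S_{1:k,k+1}$. Finally: $\begin{bmatrix}\mathcal Y_{1:p-1,p}\\ \Omega_p\end{bmatrix}=[\mathcal Q_{p-1}\ V_p]^TV_p$; $Y_{pp}=\mathrm{chol}(\Omega_p-\mathcal Y_{1:p-1,p}^T\mathcal Y_{1:p-1,p})$; $Q_p=(V_p-\mathcal Q_{p-1}\mathcal Y_{1:p-1,p})Y_{pp}^{-1}$; $\mathcal R_{1:p-1,p}=\mathcal S_{1:p-1,p}+\mathcal Y_{1:p-1,p}$; $R_{pp}=Y_{pp}$. All return $\mathcal Q=[Q_1,\dots,Q_p]$ and the upper triangular $\mathcal R=(R_{ij})$. *)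

(* Defs.v *)
From HB Require Import structures.
From mathcomp Require Import all_boot all_order all_algebra.
From mathcomp Require Import all_classical all_reals.

Set Implicit Arguments.
Unset Strict Implicit.
Unset Printing Implicit Defensive.

Import Order.TTheory GRing.Theory Num.Theory.
Local Open Scope ring_scope.

Section Norms.
Local Open Scope classical_set_scope.
Local Open Scope ring_scope.
Variable R : realType.

Definition norm2 n (x : 'cV[R]_n) : R := Num.sqrt (\sum_i x i 0 ^+ 2).

Definition opnorm2 m n (A : 'M[R]_(m, n)) : R :=
  sup [set norm2 (A *m x) | x in [set x : 'cV[R]_n | norm2 x = 1]].

(* Square roots of the eigenvalues of X^T X; for n <= m these are all the
   singular values of X, zero included. *)
Definition singular_values m n (X : 'M[R]_(m, n)) : set R :=
  [set s | 0 <= s /\ eigenvalue (X^T *m X) (s ^+ 2)].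

Definition sigma_max m n (X : 'M[R]_(m, n)) : R := sup (singular_values X).
Definition sigma_min m n (X : 'M[R]_(m, n)) : R := inf (singular_values X).

(* +oo on rank-deficient matrices, so that a bound on kappa X entails full
   column rank; the division in R would give 0 there. *)
Definition kappa m n (X : 'M[R]_(m, n)) : \bar R :=
  if sigma_min X == 0 then +oo%E else (sigma_max X / sigma_min X)%:E.

End Norms.

(* Floating-point computations are modelled by relations "the value z is a
   possible computed result of the operation", so that the choice of the
   rounding errors (and of the order of summation) is arbitrary. *)
Section Arithmetic.
Variables (R : realType) (eps : R).

Definition fl (x z : R) : Prop := exists2 d : R, `|d| <= eps & z = x * (1 + d).

(* Exceptional operations (division by zero, square root of a negative number)
   leave the result unconstrained; in particular, a property of all computed
   results also covers the runs that break down. *)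
Definition fl_div (x y z : R) : Prop := y != 0 -> fl (x / y) z.
Definition fl_sqrt (x z : R) : Prop := 0 <= x -> fl (Num.sqrt x) z.

(* Summation of the terms [f i], [i \in A] (A nonempty), in any order. *)
Inductive fl_sum (I : finType) (f : I -> R) : {set I} -> R -> Prop :=
| FlSum1 i : fl_sum f [set i] (f i)
| FlSumD (A B : {set I}) x y z : [disjoint A & B] ->
    fl_sum f A x -> fl_sum f B y -> fl (x + y) z -> fl_sum f (A :|: B) z.

Definition fl_inner n (x y : 'cV[R]_n) (z : R) : Prop :=
  exists2 w : 'I_n -> R, (forall i, fl (x i 0 * y i 0) (w i))
                       & fl_sum w [set: 'I_n] z.

(* x - \sum_(j in A) a j * b j, the terms being accumulated in any order
   (in particular as the difference of x and the computed sum). *)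
Definition fl_submul (x : R) (I : finType) (A : {set I}) (a b : I -> R) (z : R)
    : Prop :=
  exists2 w : I -> R, (forall j, j \in A -> fl (a j * b j) (w j))
    & fl_sum (fun o : option I => if o is Some j then - w j else x)
             (None |: [set Some j | j in A]) z.

(* x r^-1, by a division or by a multiplication with the computed inverse. *)
Definition fl_quot (x r z : R) : Prop :=
  fl_div x r z \/ exists2 t, fl_div 1 r t & fl (x * t) z.

(* An entry of a batched matrix product [A1 A2]^T [B1 B2], which is the inner
   product of a column x of [A1 A2] with a column y of [B1 B2]. On top of the
   rounding errors of the inner product, batching may introduce an additional
   error, of order eps relative to the columns involved; beta is the constant
   hidden in this O(eps). *)
Definition fl_batched (beta : R) n (x y : 'cV[R]_n) (z : R) : Prop :=
  exists2 z0, fl_inner x y z0 & `|z - z0| <= beta * eps * (norm2 x * norm2 y).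

(* [q, r] = IO(x), which is also IO_A for a single column. *)
Definition fl_IO n (x q : 'cV[R]_n) (r : R) : Prop :=
  (exists2 a, fl_inner x x a & fl_sqrt a r)
  /\ forall i, fl_quot (x i 0) r (q i 0).

End Arithmetic.

(* [BCGSIA_*S X Q Rf]: Q and Rf are possible computed factors for X. Column
   indices start at 0, so that the columns of the matrix Q_{k-1} of the
   previous vectors are those of index j < k. Only the entries of the auxiliary
   matrices that are mentioned are computed; the others are irrelevant. For
   p = 1 all the variants reduce to the initial call of IO_A. *)
Section Algorithms.
Variables (R : realType) (eps beta : R) (m p : nat).
Implicit Types (X Q V W : 'M[R]_(m, p)) (S Y Z Rf : 'M[R]_p).

Definition before (k : 'I_p) : {set 'I_p} := [set j : 'I_p | (j < k)%N].

(* column k of W is the computed U_k - Q_{k-1} T_{1:k-1,k} *)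
Definition fl_update (U Q : 'M[R]_(m, p)) (T : 'M[R]_p) (W : 'M[R]_(m, p))
    (k : 'I_p) : Prop :=
  forall i, fl_submul eps (U i k) (before k) (Q i) (T^~ k) (W i k).

Definition fl_init X Q Rf : Prop :=
  forall k : 'I_p, k = 0%N :> nat ->
    fl_IO eps (col k X) (col k Q) (Rf k k).

Definition fl_Rcol S Y Rf (k : 'I_p) : Prop :=
  (forall j : 'I_p, (j < k)%N -> fl eps (S j k + Y j k) (Rf j k))
  /\ Rf k k = Y k k.

Definition upper_triangular Rf : Prop :=
  forall i j : 'I_p, (j < i)%N -> Rf i j = 0.

Definition fl_S_direct X Q S (k : 'I_p) : Prop :=
  forall j : 'I_p, (j < k)%N -> fl_inner eps (col j Q) (col k X) (S j k).

(* The second orthogonalization of column k in the variants 2S and 1S: batched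
   computation of Y_{1:k-1,k} and Omega_k, Y_kk by Cholesky, and
   Q_k = (V_k - Q_{k-1} Y_{1:k-1,k}) Y_kk^-1. *)
Definition fl_cholesky_step Q V Y (k : 'I_p) : Prop :=
  [/\ forall j : 'I_p, (j < k)%N ->
        fl_batched eps beta (col j Q) (col k V) (Y j k),
      exists Omega a : R,
        [/\ fl_batched eps beta (col k V) (col k V) Omega,
            fl_submul eps Omega (before k) (Y^~ k) (Y^~ k) a
          & fl_sqrt eps a (Y k k)]
    & exists2 W, fl_update V Q Y W k
               & forall i, fl_quot eps (W i k) (Y k k) (Q i k)].

Definition BCGSIA_3S X Q Rf : Prop :=
  exists S Y V W,
  [/\ upper_triangular Rf, fl_init X Q Rf &
      forall k : 'I_p, (0 < k)%N ->
      [/\ fl_S_direct X Q S k,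
          fl_update X Q S V k,
          forall j : 'I_p, (j < k)%N ->
            fl_inner eps (col j Q) (col k V) (Y j k),
          fl_update V Q Y W k /\ fl_IO eps (col k W) (col k Q) (Y k k)
        & fl_Rcol S Y Rf k]].

Definition BCGSIA_2S X Q Rf : Prop :=
  exists S Y V,
  [/\ upper_triangular Rf, fl_init X Q Rf &
      forall k : 'I_p, (0 < k)%N ->
      [/\ fl_S_direct X Q S k,
          fl_update X Q S V k,
          fl_cholesky_step Q V Y k
        & fl_Rcol S Y Rf k]].

(* [fl_S_delayed _ k l]: the computation, during step k, of the column
   l = k + 1 of S, from the batched products Z_{k-1} = Q_{k-1}^T X_{k+1} and
   P_k = V_k^T X_{k+1}. *)
Definition fl_S_delayed X Q V Y S (k l : 'I_p) : Prop :=
  exists (Z : 'I_p -> R) (P t : R),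
  [/\ forall j : 'I_p, (j < k)%N ->
        fl_batched eps beta (col j Q) (col l X) (Z j),
      fl_batched eps beta (col k V) (col l X) P,
      forall j : 'I_p, (j < k)%N -> S j l = Z j,
      fl_submul eps P (before k) (Y^~ k) Z t
    & fl_quot eps t (Y k k) (S k l)].

Definition BCGSIA_1S X Q Rf : Prop :=
  exists S Y V,
  [/\ upper_triangular Rf, fl_init X Q Rf,
      forall k : 'I_p, k = 1%N :> nat -> fl_S_direct X Q S k,
      forall k : 'I_p, (0 < k)%N ->
      [/\ fl_update X Q S V k,
          fl_cholesky_step Q V Y k
        & fl_Rcol S Y Rf k]
    & forall k l : 'I_p, (0 < k)%N -> l = k.+1 :> nat ->
        fl_S_delayed X Q V Y S k l].

End Algorithms.

(* Main.v *)
(* The constants hidden in O(eps) are handled by working with families of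
   quantities indexed by all runs of an algorithm, along the filter generated by
   the sets of runs with c eps kappa(X) <= 1, c > 0; every estimate is then a
   Landau relation, and uniform constants are extracted only at the end.

   The proof is an induction on the column index k, all the errors being relative
   to the norm of x_k. Since the previous columns satisfy X + dX = Q R with R
   triangular, x_k - Q s is X c up to a small perturbation, for some c with
   |c| >= 1, so its norm is at least a fixed fraction of sigma_min(X). Hence
   eps |x_k| = o(|v_k|), and as Q^T v_k = O(eps |x_k|), the second projection only
   perturbs v_k by o(|v_k|); its rounding errors O(eps |v_k|) are thus O(eps)
   relative to the norm of w_k, which gives orthogonality to O(eps). The
   Pythagorean formula |v_k|^2 - |y|^2 agrees with |w_k|^2 up to O(eps |v_k|^2),
   so normalizing with it is as good as normalizing with |w_k|. In the variant
   1S the delayed inner product, multiplied by Y_kk, is w_k^T x_(k+1) up to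
   O(eps |v_k| |x_(k+1)|). *)
Require Import Defs.
From mathcomp Require Import all_boot all_order all_algebra.
From mathcomp Require Import all_classical all_reals.
From mathcomp Require Import ring lra.

Set Implicit Arguments.
Unset Strict Implicit.
Unset Printing Implicit Defensive.

Import Order.TTheory GRing.Theory Num.Theory.
Local Open Scope ring_scope.
Local Open Scope classical_set_scope.

(** * Extreme singular values *)

Section EuclideanNorm.
Variable R : realType.

Definition dot n (x y : 'cV[R]_n) : R := \sum_i x i 0 * y i 0.

Lemma norm2_ge0 n (x : 'cV[R]_n) : 0 <= norm2 x.
Proof. exact: sqrtr_ge0. Qed.

Lemma sqr_norm2 n (x : 'cV[R]_n) : norm2 x ^+ 2 = dot x x.
Proof. by rewrite sqr_sqrtr ?sumr_ge0 // => i _; exact: sqr_ge0. Qed.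

Lemma dotC n (x y : 'cV[R]_n) : dot x y = dot y x.
Proof. by apply: eq_bigr => i _; rewrite mulrC. Qed.

Lemma dotDl n (x y z : 'cV[R]_n) : dot (x + y) z = dot x z + dot y z.
Proof. by rewrite -big_split; apply: eq_bigr => i _; rewrite mxE mulrDl. Qed.

Lemma dotZl n a (x z : 'cV[R]_n) : dot (a *: x) z = a * dot x z.
Proof. by rewrite mulr_sumr; apply: eq_bigr => i _; rewrite mxE mulrA. Qed.

Lemma dotDr n (x y z : 'cV[R]_n) : dot z (x + y) = dot z x + dot z y.
Proof. by rewrite dotC dotDl !(dotC z). Qed.

Lemma dotZr n a (x z : 'cV[R]_n) : dot z (a *: x) = a * dot z x.
Proof. by rewrite dotC dotZl dotC. Qed.

Lemma dot_mulmx m n (A : 'M[R]_(m, n)) x y : dot x (A *m y) = dot (A^T *m x) y.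
Proof.
transitivity (\sum_i \sum_j x i 0 * A i j * y j 0).
  apply: eq_bigr => i _; rewrite mxE mulr_sumr.
  by apply: eq_bigr => j _; rewrite mulrA.
rewrite exchange_big; apply: eq_bigr => j _; rewrite mxE mulr_suml.
by apply: eq_bigr => i _; rewrite mxE [x i 0 * _]mulrC.
Qed.

Lemma ler_norm2_sum n (x : 'cV[R]_n) : norm2 x <= \sum_i `|x i 0|.
Proof.
have s0 : 0 <= \sum_i `|x i 0| by apply: sumr_ge0.
rewrite -ler_sqr ?nnegrE ?norm2_ge0 // sqr_norm2 expr2 mulr_suml.
apply: ler_sum => i _; apply: le_trans (ler_norm _) _.
rewrite normrM ler_wpM2l //.
by rewrite (bigD1 i) //= lerDl sumr_ge0.
Qed.

Lemma ler_coord_norm2 n (x : 'cV[R]_n) i : `|x i 0| <= norm2 x.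
Proof.
rewrite -sqrtr_sqr ler_wsqrtr // (bigD1 i) //= lerDl sumr_ge0 // => j _.
exact: sqr_ge0.
Qed.

Lemma norm2_gt0 n (x : 'cV[R]_n) : x != 0 -> 0 < norm2 x.
Proof.
move=> x0; rewrite lt0r norm2_ge0 andbT; apply: contra x0 => /eqP nx.
apply/eqP/matrixP => i j; rewrite ord1 mxE; apply/eqP.
by rewrite -normr_le0 -nx ler_coord_norm2.
Qed.

Lemma norm2Z n a (x : 'cV[R]_n) : norm2 (a *: x) = `|a| * norm2 x.
Proof.
rewrite -[LHS]ger0_norm ?norm2_ge0// -sqrtr_sqr sqr_norm2 dotZl dotZr mulrA.
by rewrite -expr2 -sqr_norm2 -exprMn sqrtr_sqr normrM [X in _ * X]ger0_norm ?norm2_ge0.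
Qed.

Lemma norm2_normalize n (x : 'cV[R]_n) :
  x != 0 -> norm2 ((norm2 x)^-1 *: x) = 1.
Proof.
move=> /norm2_gt0 x0; rewrite norm2Z ger0_norm ?invr_ge0 ?norm2_ge0 //.
by rewrite mulVf // gt_eqF.
Qed.

Lemma norm2_delta n (i : 'I_n) : norm2 (delta_mx i 0 : 'cV[R]_n) = 1.
Proof.
rewrite /norm2 (bigD1 i) //= big1 ?addr0 ?mxE ?eqxx ?expr1n ?sqrtr1 //.
by move=> j ji; rewrite mxE (negPf ji) expr0n.
Qed.

(** A crude upper bound of the operator norm; factors depending only on the dimensions are harmless
    throughout. *)
Definition absum m n (A : 'M[R]_(m, n)) := \sum_i \sum_j `|A i j|.

Lemma absum_ge0 m n (A : 'M[R]_(m, n)) : 0 <= absum A.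
Proof. by do 2!apply: sumr_ge0 => ? _. Qed.

Lemma norm2_mulmx m n (A : 'M[R]_(m, n)) x : norm2 (A *m x) <= absum A * norm2 x.
Proof.
apply: le_trans (ler_norm2_sum _) _; rewrite mulr_suml; apply: ler_sum => i _.
rewrite mxE mulr_suml; apply: le_trans (ler_norm_sum _ _ _) _.
by apply: ler_sum => j _; rewrite normrM ler_wpM2l // ler_coord_norm2.
Qed.

Lemma ler_dot_mulmx n (A : 'M[R]_n) x : `|dot x (A *m x)| <= absum A * dot x x.
Proof.
rewrite -sqr_norm2 mulr_suml; apply: le_trans (ler_norm_sum _ _ _) _.
apply: ler_sum => i _; rewrite normrM mxE mulr_suml.
apply: (@le_trans _ _ (norm2 x * \sum_j `|A i j| * norm2 x)).
  apply: ler_pM => //; first exact: ler_coord_norm2.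
  apply: le_trans (ler_norm_sum _ _ _) _.
  by apply: ler_sum => j _; rewrite normrM ler_wpM2l // ler_coord_norm2.
by rewrite mulr_sumr; apply: ler_sum => j _; rewrite mulrCA expr2.
Qed.

Lemma opnorm2_le_absum m n (A : 'M[R]_(m, n)) : (0 < n)%N -> opnorm2 A <= absum A.
Proof.
move=> n0; apply: ge_sup.
  exists (norm2 (A *m delta_mx (Ordinal n0) 0)).
  by exists (delta_mx (Ordinal n0) 0) => //; exact: norm2_delta.
by move=> _ [x /= x1 <-]; rewrite (le_trans (norm2_mulmx _ _)) // x1 mulr1.
Qed.

Lemma norm2_col_le_opnorm2 m n (A : 'M[R]_(m, n)) k : norm2 (col k A) <= opnorm2 A.
Proof.
apply: ub_le_sup; last by exists (delta_mx k 0); rewrite /= ?norm2_delta // colE.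
by exists (absum A) => _ [x /= x1 <-]; rewrite (le_trans (norm2_mulmx _ _)) // x1 mulr1.
Qed.

(* The infimum mu of the Rayleigh quotient is an eigenvalue: otherwise
   [B = A - mu] is invertible and positive semidefinite, and the positivity of
   the form at [x - s B x] for a small s gives a positive lower bound of the
   Rayleigh quotient of B. *)
Lemma sym_min_eigenvalue n (A : 'M[R]_n) : (0 < n)%N -> A^T = A ->
  exists2 mu, eigenvalue A mu & forall x, mu * dot x x <= dot x (A *m x).
Proof.
move=> n0 symA.
pose E : set R := [set dot x (A *m x) | x in [set x : 'cV[R]_n | norm2 x = 1]].
have E0 : E !=set0.
  exists (dot (delta_mx (Ordinal n0) 0) (A *m delta_mx (Ordinal n0) 0)).
  by exists (delta_mx (Ordinal n0) 0) => //; exact: norm2_delta.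
have lE : has_lbound E.
  exists (- absum A) => _ [x /= x1 <-]; have := ler_dot_mulmx A x.
  by rewrite -sqr_norm2 x1 expr1n mulr1 ler_norml => /andP[].
exists (inf E).
  rewrite /eigenvalue /eigenspace kermx_eq0 row_free_unit; apply/negP => uB.
  set B := A - _ in uB.
  have BE x : dot x (B *m x) = dot x (A *m x) - inf E * dot x x.
    by rewrite mulmxBl mul_scalar_mx -scaleNr dotDr dotZr mulNr.
  have symB : B^T = B by rewrite linearB /= tr_scalar_mx symA.
  have psdB x : 0 <= dot x (B *m x).
    have [->|x0] := eqVneq x 0.
      by rewrite mulmx0 /dot big1 // => i _; rewrite mxE mul0r.
    rewrite BE subr_ge0 -sqr_norm2.
    have := norm2_gt0 x0 => nx.
    rewrite -ler_pdivlMr ?exprn_gt0 //; apply: inf_lbound => //.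
    exists ((norm2 x)^-1 *: x); first exact: norm2_normalize.
    rewrite -scalemxAr dotZl dotZr mulrA -expr2 exprVn; exact: mulrC.
  (* [L] and [K] bound the norms of [B] and of its inverse; the added 1 makes them positive. *)
  pose L := absum B + 1; have L0 : 0 < L by rewrite ltr_wpDl ?absum_ge0.
  pose K := absum (invmx B) + 1; have K0 : 0 < K by rewrite ltr_wpDl ?absum_ge0.
  have lowB x : dot x x / (L * K ^+ 2) <= dot x (B *m x).
    set y := B *m x.
    have xy : dot x x <= K ^+ 2 * dot y y.
      rewrite -!sqr_norm2 -exprMn ler_sqr ?nnegrE ?norm2_ge0 ?mulr_ge0 ?norm2_ge0 ?(ltW K0) //.
      rewrite -{1}[x](mulKmx uB); apply: le_trans (norm2_mulmx _ _) _.
      by rewrite ler_wpM2r ?norm2_ge0 // lerDl.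
    (* The small step is 1/[L]: since y^T B y <= [L] |y|^2, positivity at x - y/[L] gives |y|^2/[L]
       <= x^T y. *)
    have := psdB (x + (- L^-1) *: y); rewrite mulmxDr -scalemxAr !(dotDl, dotDr, dotZl, dotZr).
    have -> : dot x (B *m y) = dot y y by rewrite dot_mulmx symB.
    rewrite -/y => h.
    have yy : dot y (B *m y) <= L * dot y y.
      apply: le_trans (ler_norm _) _; apply: le_trans (ler_dot_mulmx _ _) _.
      by rewrite ler_wpM2r // -?sqr_norm2 ?exprn_ge0 ?norm2_ge0 // lerDl.
    have {}h : dot y y / L <= dot x y.
      have : L^-1 * L^-1 * dot y (B *m y) <= L^-1 * L^-1 * (L * dot y y).
        by rewrite ler_wpM2l // mulr_ge0 // invr_ge0 ltW.
      have -> : L^-1 * L^-1 * (L * dot y y) = L^-1 * dot y y by field; rewrite gt_eqF.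
      by move: h; lra.
    apply: le_trans h; rewrite ler_pdivrMr ?mulr_gt0 ?exprn_gt0 //.
    have -> // : dot y y / L * (L * K ^+ 2) = K ^+ 2 * dot y y.
    by field; rewrite gt_eqF.
  (* The Rayleigh quotient of [A] would exceed its own infimum by a fixed positive amount. *)
  have : inf E + (L * K ^+ 2)^-1 <= inf E.
    apply: lb_le_inf => // _ [x /= x1 <-]; have := lowB x.
    by rewrite BE -sqr_norm2 x1 expr1n mul1r mulr1; lra.
  by rewrite gerDl leNgt invr_gt0 mulr_gt0 ?exprn_gt0.
move=> x; have [->|x0] := eqVneq x 0.
  by rewrite mulmx0 /dot !big1 ?mulr0 // => i _; rewrite mxE mul0r.
rewrite -sqr_norm2; have nx := norm2_gt0 x0.
rewrite -ler_pdivlMr ?exprn_gt0 //; apply: inf_lbound => //.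
exists ((norm2 x)^-1 *: x); first exact: norm2_normalize.
rewrite -scalemxAr dotZl dotZr mulrA -expr2 exprVn; exact: mulrC.
Qed.

Lemma dot_gram m n (X : 'M[R]_(m, n)) x : dot x (X^T *m X *m x) = norm2 (X *m x) ^+ 2.
Proof. by rewrite -mulmxA dot_mulmx trmxK sqr_norm2. Qed.

(** The square root of the least eigenvalue [mu] of the Gram matrix is a singular value, hence at
    least [sigma_min X]; the Rayleigh bound for [mu] concludes. *)
Lemma sigma_min_le m n (X : 'M[R]_(m, n)) x : (0 < n)%N ->
  sigma_min X * norm2 x <= norm2 (X *m x).
Proof.
move=> n0.
have [|mu emu lmu] := @sym_min_eigenvalue _ (X^T *m X) n0.
  by rewrite trmx_mul trmxK.
have lmu' y : mu * norm2 y ^+ 2 <= norm2 (X *m y) ^+ 2.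
  by rewrite -dot_gram sqr_norm2.
have mu0 : 0 <= mu.
  (* Eigenvectors are row vectors; as the Gram matrix is symmetric, the transpose is a column
     eigenvector. *)
  have /eigenvalueP[v vE v0] := emu.
  have v0' : v^T != 0 by rewrite -(inj_eq trmx_inj) trmxK trmx0.
  have : 0 <= mu * norm2 v^T ^+ 2.
    rewrite sqr_norm2 -dotZr; have -> : mu *: v^T = X^T *m X *m v^T.
      by rewrite -linearZ /= -vE !trmx_mul !trmxK.
    by rewrite dot_gram sqr_ge0.
  by rewrite pmulr_lge0 // exprn_gt0 // norm2_gt0.
have s : sigma_min X <= Num.sqrt mu.
  apply: ge_inf; first by exists 0 => s [].
  by split; [exact: sqrtr_ge0|rewrite sqr_sqrtr].
apply: (@le_trans _ _ (Num.sqrt mu * norm2 x)); first by rewrite ler_wpM2r ?norm2_ge0.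
rewrite -ler_sqr ?nnegrE ?mulr_ge0 ?norm2_ge0 ?sqrtr_ge0 //.
by rewrite exprMn (sqr_sqrtr mu0).
Qed.

(** The least eigenvalue of the negated Gram matrix is minus the largest one of the Gram matrix. *)
Lemma sigma_max_ge m n (X : 'M[R]_(m, n)) x : (0 < n)%N ->
  norm2 (X *m x) <= sigma_max X * norm2 x.
Proof.
move=> n0.
have [|mu emu lmu] := @sym_min_eigenvalue _ (- (X^T *m X)) n0.
  by rewrite linearN /= trmx_mul trmxK.
have lmu' y : norm2 (X *m y) ^+ 2 <= - mu * norm2 y ^+ 2.
  have := lmu y; rewrite mulNmx -scaleN1r dotZr dot_gram -sqr_norm2; lra.
have mu0 : 0 <= - mu.
  have := le_trans (sqr_ge0 _) (lmu' (delta_mx (Ordinal n0) 0)).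
  by rewrite norm2_delta expr1n mulr1.
have emu' : eigenvalue (X^T *m X) (- mu).
  have /eigenvalueP[v vE v0] := emu; apply/eigenvalueP; exists v => //.
  by rewrite scaleNr -vE mulmxN opprK.
have s : Num.sqrt (- mu) <= sigma_max X.
  apply: ub_le_sup; last by (split; first exact: sqrtr_ge0); rewrite sqr_sqrtr.
  (* The supremum dominates its members only if the set is bounded: [absum X] bounds every singular
     value. *)
  exists (absum X) => s [s0 /eigenvalueP[v vE v0]].
  have v0' : v^T != 0 by rewrite -(inj_eq trmx_inj) trmxK trmx0.
  have nv := norm2_gt0 v0'.
  have E : (s * norm2 v^T) ^+ 2 = norm2 (X *m v^T) ^+ 2.
    rewrite -dot_gram exprMn sqr_norm2 -dotZr; congr dot.
    by rewrite -linearZ /= -vE !trmx_mul !trmxK.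
  rewrite -(ler_pM2r nv); apply: le_trans (norm2_mulmx _ _).
  rewrite -ler_sqr ?nnegrE ?mulr_ge0 ?norm2_ge0 ?(ltW nv) //.
  by rewrite E.
apply: (@le_trans _ _ (Num.sqrt (- mu) * norm2 x)); last by rewrite ler_wpM2r ?norm2_ge0.
rewrite -ler_sqr ?nnegrE ?mulr_ge0 ?norm2_ge0 ?sqrtr_ge0 //.
by rewrite exprMn (sqr_sqrtr mu0).
Qed.

End EuclideanNorm.

(** * Rounding errors *)

Section Rounding.
Variables (R : realType) (eps : R).
Hypotheses (eps_ge0 : 0 <= eps) (eps_le1 : eps <= 1).

Lemma fl_err x z : fl eps x z -> `|z - x| <= eps * `|x|.
Proof.
case=> d dle ->; have -> : x * (1 + d) - x = d * x by ring.
by rewrite normrM ler_wpM2r.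
Qed.

(** Induction on the summation tree, whence a constant valid for every order. As [eps <= 1], an
    addition at most doubles a constant a - 1 and adds one; 2 a - 1 <= a b - 1 because the other
    part is nonempty, so that b >= 2. *)
Lemma fl_sum_err (I : finType) (f : I -> R) (A : {set I}) z :
  fl_sum eps f A z ->
  (0 < #|A|)%N /\
  `|z - \sum_(i in A) f i| <= (2 ^+ #|A| - 1) * eps * \sum_(i in A) `|f i|.
Proof.
elim=> {A z} [i|A B x y z dAB _ [A0 IHA] _ [B0 IHB] /fl_err zxy].
  by rewrite cards1 !big_set1 subrr normr0 expr1; split=> //; rewrite !mulr_ge0 //; lra.
have -> : #|A :|: B| = (#|A| + #|B|)%N.
  by rewrite cardsU; move: dAB; rewrite -setI_eq0 => /eqP ->; rewrite cards0 subn0.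
split; first by rewrite addn_gt0 A0.
have sumU (g : I -> R) : \sum_(i in A :|: B) g i = \sum_(i in A) g i + \sum_(i in B) g i.
  by rewrite -bigU //; apply: eq_bigl => i; rewrite !inE.
rewrite !sumU exprD.
set a := 2 ^+ #|A| in IHA *; set b := 2 ^+ #|B| in IHB *.
set sA := \sum_(i in A) f i in IHA *; set sB := \sum_(i in B) f i in IHB *.
set tA := \sum_(i in A) `|f i| in IHA *; set tB := \sum_(i in B) `|f i| in IHB *.
have sAt : `|sA| <= tA by exact: ler_norm_sum.
have sBt : `|sB| <= tB by exact: ler_norm_sum.
have a2 : 2 <= a by rewrite /a -(prednK A0) exprS ler_peMr // exprn_ege1 //; lra.
have b2 : 2 <= b by rewrite /b -(prednK B0) exprS ler_peMr // exprn_ege1 //; lra.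
have xy : `|x + y - (sA + sB)| <= ((a - 1) * tA + (b - 1) * tB) * eps.
  have -> : x + y - (sA + sB) = (x - sA) + (y - sB) by ring.
  by apply: le_trans (ler_normD _ _) _; lra.
have tA0 : 0 <= tA by apply: le_trans sAt.
have tB0 : 0 <= tB by apply: le_trans sBt.
have h : `|x + y| <= tA + tB + ((a - 1) * tA + (b - 1) * tB) * eps.
  have := ler_normD (x + y - (sA + sB)) (sA + sB).
  by have := ler_normD sA sB; rewrite subrK; lra.
have h' : `|z - (sA + sB)| <= eps * `|x + y| + ((a - 1) * tA + (b - 1) * tB) * eps.
  have -> : z - (sA + sB) = (z - (x + y)) + (x + y - (sA + sB)) by ring.
  by apply: le_trans (ler_normD _ _) _; lra.
set U := (a - 1) * tA + _ in h h'.
have U0 : 0 <= U by rewrite addr_ge0 // mulr_ge0 // subr_ge0; lra.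
have {}h' : `|z - (sA + sB)| <= eps * (tA + tB + 2 * U).
  apply: le_trans h' _; have : eps * `|x + y| <= eps * (tA + tB + U * eps).
    by rewrite ler_wpM2l.
  have : eps * (U * eps) <= eps * (U * 1) by rewrite !ler_wpM2l.
  lra.
apply: le_trans h' _; rewrite -mulrA [leRHS]mulrCA ler_wpM2l // /U.
have : 0 <= (a * (b - 2)) * tA by rewrite !mulr_ge0 //; lra.
have : 0 <= (b * (a - 2)) * tB by rewrite !mulr_ge0 //; lra.
lra.
Qed.

(** Rounding of the terms and rounding of the sum are combined; the exponent uses the whole index
    type, so that the constant depends on the dimension only. *)
Lemma fl_sum_products_err (I : finType) (f w : I -> R) (A : {set I}) z :
  (forall i, i \in A -> `|w i - f i| <= eps * `|f i|) -> fl_sum eps w A z ->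
  `|z - \sum_(i in A) f i| <= 2 ^+ #|I|.+2 * eps * \sum_(i in A) `|f i|.
Proof.
move=> wf /fl_sum_err[_ zw].
set s := \sum_(i in A) `|f i|.
have s0 : 0 <= s by exact: sumr_ge0.
have wf' : `|\sum_(i in A) w i - \sum_(i in A) f i| <= eps * s.
  rewrite -sumrB mulr_sumr; apply: le_trans (ler_norm_sum _ _ _) _.
  exact: ler_sum.
have ws : \sum_(i in A) `|w i| <= 2 * s.
  rewrite mulr_sumr; apply: ler_sum => i /wf h.
  have -> : w i = (w i - f i) + f i by ring.
  apply: le_trans (ler_normD _ _) _.
  have : eps * `|f i| <= 1 * `|f i| by rewrite ler_wpM2r.
  lra.
have a1 : 1 <= 2 ^+ #|A| :> R by rewrite exprn_ege1 //; lra.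
have aI : 2 ^+ #|A| <= 2 ^+ #|I| :> R.
  by rewrite ler_weXn2l ?max_card //; lra.
have -> : z - \sum_(i in A) f i = (z - \sum_(i in A) w i)
    + (\sum_(i in A) w i - \sum_(i in A) f i) by ring.
apply: le_trans (ler_normD _ _) _; rewrite !exprS.
move: a1 aI zw; set a := 2 ^+ #|A|; set b := 2 ^+ #|I| => a1 aI zw.
have : (a - 1) * eps * \sum_(i in A) `|w i| <= (a - 1) * eps * (2 * s).
  by rewrite ler_wpM2l // mulr_ge0 //; lra.
have : 0 <= (b - a) * (eps * s) by rewrite mulr_ge0 ?mulr_ge0 //; lra.
have : 0 <= (b - 1) * (eps * s) by rewrite mulr_ge0 ?mulr_ge0 //; lra.
have : 0 <= eps * s by rewrite mulr_ge0.
lra.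
Qed.

Lemma fl_inner_err n (x y : 'cV[R]_n) z : fl_inner eps x y z ->
  `|z - dot x y| <= 2 ^+ n.+2 * eps * \sum_i `|x i 0 * y i 0|.
Proof.
case=> w wE /(@fl_sum_products_err _ (fun i => x i 0 * y i 0)).
rewrite card_ord; under eq_bigl do rewrite inE.
under [X in _ * X]eq_bigl do rewrite inE.
by apply=> i _; exact/fl_err/wE.
Qed.

Lemma fl_submul_err x (I : finType) (A : {set I}) (a b : I -> R) z :
  fl_submul eps x A a b z ->
  `|z - (x - \sum_(j in A) a j * b j)|
    <= 2 ^+ #|I|.+3 * eps * (`|x| + \sum_(j in A) `|a j * b j|).
Proof.
case=> w wE.
(* The exact terms: [x] at [None] carries no error of its own, and the extra index raises the
   exponent by one. *)
pose f (o : option I) := if o is Some j then - (a j * b j) else x.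
move=> /(@fl_sum_products_err _ f).
have sumS (g : option I -> R) :
    \sum_(o in None |: [set Some j | j in A]) g o = g None + \sum_(j in A) g (Some j).
  rewrite big_setU1 /=; last by apply/imsetP => -[].
  by rewrite big_imset //= => j j' _ _ [].
rewrite !sumS /= sumrN card_option.
under [X in _ * (_ + X)]eq_bigr do rewrite normrN.
apply=> -[j|] /=.
  rewrite !inE /= => /imsetP[j' j'A [->]].
  by rewrite -opprD !normrN; exact/fl_err/wE.
by rewrite subrr normr0 mulr_ge0.
Qed.

(** The error is stated after multiplication by [r], the form in which it enters the residuals. The
    constant 3 covers d + d' + d d' when the quotient is rounded twice. *)
Lemma fl_quot_err (x r z : R) : r != 0 -> fl_quot eps x r z ->
  `|r * z - x| <= 3 * eps * `|x|.
Proof.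
move=> r0 [/(_ r0)[d dle ->]|[t /(_ r0)[d dle ->] [d' dle' ->]]].
  have -> : r * (x / r * (1 + d)) - x = d * x by field.
  by rewrite normrM ler_wpM2r // (le_trans dle) // ler_peMl //; lra.
have -> : r * (x * (1 / r * (1 + d)) * (1 + d')) - x = (d + d' + d * d') * x by field.
rewrite normrM ler_wpM2r //; apply: le_trans (ler_normD _ _) _.
have h : `|d * d'| <= eps * 1.
  by rewrite normrM ler_pM // (le_trans dle').
have h' : `|d + d'| <= eps + eps by apply: le_trans (ler_normD _ _) (lerD dle dle').
lra.
Qed.

End Rounding.

(** * Landau relations along a filter *)

Section Landau.
Context {R : realType} {T : Type} {F : set_system T} {FF : Filter F}.
Implicit Types f g h : T -> R.

(** No absolute value on [g]: the relation includes the eventual nonnegativity of [g]. *)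
Definition bigO f g := exists2 C, 0 < C & \forall t \near F, `|f t| <= C * g t.

(** The usual small factor is the inverse of a large [C]; [C = 0] again forces [g] to be eventually
    nonnegative. *)
Definition littleo f g := forall C, \forall t \near F, C * `|f t| <= g t.

Local Notation "f '=O_[' t ']' g" := (bigO (fun t => f) (fun t => g))
  (at level 70, t name, g at next level).
Local Notation "f '=o_[' t ']' g" := (littleo (fun t => f) (fun t => g))
  (at level 70, t name, g at next level).

Lemma bigO_near f f' g :
  (\forall t \near F, f t = f' t) -> f' t =O_[t] g t -> f t =O_[t] g t.
Proof.
by move=> ff' [C C0 h]; exists C => //; apply: filterS2 ff' h => t -> .
Qed.

Lemma bigO_eq f f' g : f =1 f' -> f' t =O_[t] g t -> f t =O_[t] g t.
Proof. by move=> ff'; apply: bigO_near; apply: nearW. Qed.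

Lemma bigO_eqr f g g' : g' =1 g -> f t =O_[t] g t -> f t =O_[t] g' t.
Proof. by move=> gg' [C C0 h]; exists C => //; apply: filterS h => t; rewrite gg'. Qed.

Lemma bigO_le f g : (\forall t \near F, `|f t| <= g t) -> f t =O_[t] g t.
Proof. by move=> h; exists 1 => //; apply: filterS h => t; rewrite mul1r. Qed.

Lemma bigO_ge0 f g : f t =O_[t] g t -> \forall t \near F, 0 <= g t.
Proof.
move=> [C C0]; apply: filterS => t h.
by rewrite -(pmulr_rge0 _ C0) (le_trans _ h).
Qed.

Lemma bigO_refl f : (\forall t \near F, 0 <= f t) -> f t =O_[t] f t.
Proof. by move=> h; apply: bigO_le; apply: filterS h => t f0; rewrite ger0_norm. Qed.

Lemma bigO_trans f g h : f t =O_[t] g t -> g t =O_[t] h t -> f t =O_[t] h t.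
Proof.
move=> [C C0 fg] [D D0 gh]; exists (C * D); first by rewrite mulr_gt0.
apply: filterS2 fg gh => t fg gh; apply: le_trans fg _.
by rewrite -mulrA ler_pM2l // (le_trans (ler_norm _)).
Qed.

Lemma bigOD f1 f2 g :
  f1 t =O_[t] g t -> f2 t =O_[t] g t -> f1 t + f2 t =O_[t] g t.
Proof.
move=> [C C0 fg] [D D0 gh]; exists (C + D); first by rewrite addr_gt0.
apply: filterS2 fg gh => t fg gh; apply: le_trans (ler_normD _ _) _.
by rewrite mulrDl lerD.
Qed.

Lemma bigON f g : f t =O_[t] g t -> - f t =O_[t] g t.
Proof. by move=> [C C0 fg]; exists C => //; apply: filterS fg => t; rewrite normrN. Qed.

Lemma bigOB f1 f2 g :
  f1 t =O_[t] g t -> f2 t =O_[t] g t -> f1 t - f2 t =O_[t] g t.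
Proof. by move=> h1 h2; apply: bigOD h1 _; exact: bigON. Qed.

Lemma bigOM f1 f2 g1 g2 :
  f1 t =O_[t] g1 t -> f2 t =O_[t] g2 t -> f1 t * f2 t =O_[t] g1 t * g2 t.
Proof.
move=> [C C0 fg] [D D0 gh]; exists (C * D); first by rewrite mulr_gt0.
by apply: filterS2 fg gh => t fg gh; rewrite mulrACA normrM ler_pM.
Qed.

Lemma bigO_cst (c : R) : c =O_[t] 1.
Proof.
exists (`|c| + 1); first by rewrite ltr_wpDl.
by apply: nearW => t; rewrite mulr1 lerDl.
Qed.

Lemma bigO_addr f g h : (\forall t \near F, 0 <= h t) ->
  f t =O_[t] g t -> f t =O_[t] g t + h t.
Proof.
move=> h0 [C C0 fg]; exists C => //; apply: filterS2 h0 fg => t h0 /le_trans; apply.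
by rewrite ler_pM2l // lerDl.
Qed.

Lemma bigO_sum (I : finType) (P : pred I) (f : I -> T -> R) g :
  (\forall t \near F, 0 <= g t) ->
  (forall i, P i -> f i t =O_[t] g t) -> \sum_(i | P i) f i t =O_[t] g t.
Proof.
move=> g0 fg.
apply: (@bigO_eq _ (\sum_(i | P i) f i)) => [t|]; first by rewrite fct_sumE.
elim/big_ind: _ => [|f1 f2 h1 h2|//].
  by apply: bigO_le; apply: filterS g0 => t; rewrite normr0.
exact: bigOD h1 h2.
Qed.

Lemma bigO_cancel f g r : (\forall t \near F, 0 < r t) ->
  f t * r t =O_[t] g t * r t -> f t =O_[t] g t.
Proof.
move=> r0 [C C0 h]; exists C => //; apply: filterS2 r0 h => t r0.
by rewrite normrM [`|r t|]gtr0_norm // mulrA ler_pM2r.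
Qed.

Lemma bigO_sqr f g : (\forall t \near F, 0 <= g t) ->
  f t ^+ 2 =O_[t] g t ^+ 2 -> f t =O_[t] g t.
Proof.
(* Since [C] <= ([C] + 1)^2, no square root of the constant is needed. *)
move=> g0 [C C0 h]; exists (C + 1); first by rewrite addr_gt0.
apply: filterS2 g0 h => t g0; rewrite normrX => h.
rewrite -ler_sqr ?nnegrE ?mulr_ge0 ?addr_ge0 ?(ltW C0) //.
apply: le_trans h _; rewrite exprMn ler_wpM2r ?sqr_ge0 //.
rewrite sqrrD; have := sqr_ge0 C; lra.
Qed.

(** Eventually C h is at most half of [f], and it is moved to the left-hand side. *)
Lemma bigO_absorb f g h : (\forall t \near F, 0 <= f t) ->
  f t =O_[t] g t + h t -> h t =o_[t] f t -> f t =O_[t] g t.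
Proof.
move=> f0 [C C0 fgh] /(_ (2 * C)) hf; exists (2 * C); first by rewrite mulr_gt0.
apply: filterS3 f0 fgh hf => t f0; rewrite ger0_norm // => fgh hf.
have : C * h t <= C * `|h t| by rewrite ler_pM2l // ler_norm.
lra.
Qed.

Lemma bigO_littleo_trans f g h :
  f t =O_[t] g t -> g t =o_[t] h t -> f t =o_[t] h t.
Proof.
move=> [C C0 fg] gh D; apply: filterS2 fg (gh (`|D| * C)) => t fg; apply: le_trans.
apply: (@le_trans _ _ (`|D| * `|f t|)); first by rewrite ler_wpM2r // ler_norm.
rewrite -mulrA ler_wpM2l //; apply: le_trans fg _.
by rewrite ler_pM2l // ler_norm.
Qed.

Lemma littleo_bigO_trans f g h :
  f t =o_[t] g t -> g t =O_[t] h t -> f t =o_[t] h t.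
Proof.
move=> fg [C C0 gh] D; apply: filterS2 (fg (D * C)) gh => t fgt ght.
rewrite -(ler_pM2l C0); apply: le_trans (le_trans (ler_norm _) ght).
by rewrite mulrA [C * D]mulrC.
Qed.

Lemma littleo_bigO f g : f t =o_[t] g t -> f t =O_[t] g t.
Proof. by move=> /(_ 1) h; apply: bigO_le; apply: filterS h => t; rewrite mul1r. Qed.

Lemma littleo_near f f' g :
  (\forall t \near F, f t = f' t) -> f' t =o_[t] g t -> f t =o_[t] g t.
Proof. by move=> ff' h D; apply: filterS2 ff' (h D) => t ->. Qed.

Lemma littleo_eq f f' g : f =1 f' -> f' t =o_[t] g t -> f t =o_[t] g t.
Proof. by move=> ff'; apply: littleo_near; apply: nearW. Qed.

Lemma littleoD f1 f2 g :
  f1 t =o_[t] g t -> f2 t =o_[t] g t -> f1 t + f2 t =o_[t] g t.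
Proof.
move=> h1 h2 D; apply: filterS2 (h1 (2 * `|D|)) (h2 (2 * `|D|)) => t a1 a2.
apply: (@le_trans _ _ (`|D| * (`|f1 t| + `|f2 t|))); last lra.
apply: (@le_trans _ _ (`|D| * `|f1 t + f2 t|)); first by rewrite ler_wpM2r // ler_norm.
by rewrite ler_wpM2l // ler_normD.
Qed.

Lemma littleoN f g : f t =o_[t] g t -> - f t =o_[t] g t.
Proof. by move=> h D; apply: filterS (h D) => t; rewrite normrN. Qed.

Lemma littleo_sum (I : finType) (P : pred I) (f : I -> T -> R) g :
  (\forall t \near F, 0 <= g t) ->
  (forall i, P i -> f i t =o_[t] g t) -> \sum_(i | P i) f i t =o_[t] g t.
Proof.
move=> g0 fg.
apply: (@littleo_eq _ (\sum_(i | P i) f i)) => [t|]; first by rewrite fct_sumE.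
elim/big_ind: _ => [|f1 f2 h1 h2|//].
  by move=> D; apply: filterS g0 => t; rewrite normr0 mulr0.
exact: littleoD h1 h2.
Qed.

Lemma littleoM f1 f2 g1 g2 :
  f1 t =o_[t] g1 t -> f2 t =O_[t] g2 t -> f1 t * f2 t =o_[t] g1 t * g2 t.
Proof.
move=> h1 [C C0 h2] D; apply: filterS2 (h1 (`|D| * C)) h2 => t a1 a2.
have a2' : `|f2 t| / C <= g2 t by rewrite ler_pdivrMr // mulrC.
apply: (@le_trans _ _ (`|D| * C * `|f1 t| * (`|f2 t| / C))).
  rewrite normrM; have -> : `|D| * C * `|f1 t| * (`|f2 t| / C) = `|D| * (`|f1 t| * `|f2 t|).
    by field; rewrite gt_eqF.
  by rewrite ler_wpM2r ?mulr_ge0 // ler_norm.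
by apply: ler_pM => //; rewrite ?mulr_ge0 ?invr_ge0 // ltW.
Qed.

Lemma littleo_equiv f g : f t - g t =o_[t] g t -> \forall t \near F, g t <= 2 * f t.
Proof.
move=> /(_ 2); apply: filterS => t; have := ler_norm (- (f t - g t)).
rewrite normrN; lra.
Qed.

End Landau.

(** * Rounding errors as Landau relations, and normalization of a vector *)

Section ErrorAnalysis.
Context {R : realType} {T : Type} {F : set_system T} {FF : Filter F}.
Variables (m p : nat) (eps : T -> R) (beta : R).

Local Notation "f '=O_[' t ']' g" := (bigO (F := F) (fun t => f) (fun t => g))
  (at level 70, t name, g at next level).
Local Notation "f '=o_[' t ']' g" := (littleo (F := F) (fun t => f) (fun t => g))
  (at level 70, t name, g at next level).

Hypotheses (eps_gt0 : \forall t \near F, 0 < eps t) (eps_o1 : eps t =o_[t] 1).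
Hypothesis beta_ge0 : 0 <= beta.

Lemma eps_ge0 : \forall t \near F, 0 <= eps t.
Proof. by apply: filterS eps_gt0 => t /ltW. Qed.

Lemma eps_le1 : \forall t \near F, eps t <= 1.
Proof. by apply: filterS (eps_o1 1) => t; rewrite mul1r; apply: le_trans; exact: ler_norm. Qed.

Lemma eps_bigO f : (\forall t \near F, 0 <= f t) -> eps t * f t =O_[t] f t.
Proof.
move=> f0; apply: bigO_le; apply: filterS3 f0 eps_ge0 eps_le1 => t f0 e0 e1.
by rewrite ger0_norm ?mulr_ge0 // ler_piMl.
Qed.

Lemma eps_littleo f : (\forall t \near F, 0 <= f t) -> eps t * f t =o_[t] f t.
Proof.
move=> f0; apply: (littleo_bigO_trans (littleoM eps_o1 (bigO_refl f0))).
by apply: bigO_le; apply: filterS f0 => t f0; rewrite mul1r ger0_norm.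
Qed.

Lemma bigO_epsM f g : f t =O_[t] g t -> eps t * f t =O_[t] eps t * g t.
Proof. by apply: bigOM; apply: bigO_refl; exact: eps_ge0. Qed.

Lemma bigO_eps f g : f t =O_[t] eps t * g t -> (\forall t \near F, 0 <= g t) ->
  f t =O_[t] g t.
Proof. by move=> fg g0; apply: bigO_trans fg _; exact: eps_bigO. Qed.

(** Coordinatewise bounds are stable under sums and products; in fixed dimension they amount to a
    bound of the norm. *)
Definition vbigO n (u : T -> 'cV[R]_n) (g : T -> R) := forall i, u t i 0 =O_[t] g t.

Lemma vbigO_norm2 n (u : T -> 'cV[R]_n) : vbigO u (fun t => norm2 (u t)).
Proof. by move=> i; apply: bigO_le; apply: nearW => t; exact: ler_coord_norm2. Qed.

Lemma vbigO_trans n (u : T -> 'cV[R]_n) f g :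
  vbigO u f -> f t =O_[t] g t -> vbigO u g.
Proof. by move=> uf fg i; exact: bigO_trans fg. Qed.

Lemma norm2_bigO n (u : T -> 'cV[R]_n) g : (\forall t \near F, 0 <= g t) ->
  vbigO u g -> norm2 (u t) =O_[t] g t.
Proof.
move=> g0 ug; apply: (@bigO_trans _ _ _ _ _ (fun t => \sum_i `|u t i 0|)).
  apply: bigO_le; apply: nearW => t.
  by rewrite ger0_norm ?norm2_ge0 // ler_norm2_sum.
apply: bigO_sum => // i _; have [C C0 h] := ug i.
by exists C => //; apply: filterS h => t; rewrite normr_id.
Qed.

Lemma dot_bigO n (u v : T -> 'cV[R]_n) f g :
  (\forall t \near F, 0 <= f t) -> (\forall t \near F, 0 <= g t) ->
  vbigO u f -> vbigO v g -> dot (u t) (v t) =O_[t] f t * g t.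
Proof.
move=> f0 g0 uf vg; apply: bigO_sum => [|i _]; last exact: bigOM.
by apply: filterS2 f0 g0 => t; exact: mulr_ge0.
Qed.

Lemma fl_bigO (x z : T -> R) g : (\forall t \near F, fl (eps t) (x t) (z t)) ->
  x t =O_[t] g t -> z t - x t =O_[t] eps t * g t.
Proof.
move=> h xg; apply: (@bigO_trans _ _ _ _ _ (fun t => eps t * `|x t|)).
  by apply: bigO_le; apply: filterS h => t /fl_err.
apply: bigO_epsM; have [C C0 k] := xg.
by exists C => //; apply: filterS k => t; rewrite normr_id.
Qed.

(** Ordinary inner products are batched ones without additional error, so that a single analysis
    serves all variants. *)
Lemma fl_inner_batched n (u v : T -> 'cV[R]_n) (z : T -> R) :
  (\forall t \near F, fl_inner (eps t) (u t) (v t) (z t)) ->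
  \forall t \near F, fl_batched (eps t) beta (u t) (v t) (z t).
Proof.
move=> h; apply: filterS2 eps_ge0 h => t e0 h; exists (z t) => //.
by rewrite subrr normr0 !mulr_ge0 ?norm2_ge0.
Qed.

Lemma fl_batched_bigO n (u v : T -> 'cV[R]_n) (z : T -> R) :
  (\forall t \near F, fl_batched (eps t) beta (u t) (v t) (z t)) ->
  z t - dot (u t) (v t) =O_[t] eps t * (norm2 (u t) * norm2 (v t)).
Proof.
(* The factor [n] comes from bounding each |u_i v_i| by |u| |v|, and the final 1 makes the constant
   positive. *)
move=> h; pose C : R := beta + 2 ^+ n.+2 * n%:R + 1; exists C.
  by rewrite ltr_wpDl // addr_ge0 // mulr_ge0 // exprn_ge0.
apply: filterS3 eps_ge0 eps_le1 h => t e0 e1 [z0 /(fl_inner_err e0 e1) h1 h2].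
set N := norm2 (u t) * norm2 (v t) in h2 *.
have N0 : 0 <= N by rewrite mulr_ge0 ?norm2_ge0.
have h3 : \sum_i `|u t i 0 * v t i 0| <= n%:R * N.
  rewrite mulr_natl -[n in leRHS]card_ord -sumr_const; apply: ler_sum => i _.
  by rewrite normrM ler_pM ?ler_coord_norm2.
have h4 : `|z0 - dot (u t) (v t)| <= 2 ^+ n.+2 * eps t * (n%:R * N).
  by apply: le_trans h1 _; rewrite ler_wpM2l // mulr_ge0 // exprn_ge0.
have -> : z t - dot (u t) (v t) = (z t - z0) + (z0 - dot (u t) (v t)) by ring.
apply: le_trans (ler_normD _ _) _.
have : 0 <= eps t * N by rewrite mulr_ge0.
rewrite /C; move: (2 ^+ n.+2) h4 => a h4; lra.
Qed.

Lemma fl_submul_bigO (x z g : T -> R) (I : finType) (A : {set I}) (a b : T -> I -> R) :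
  (\forall t \near F, fl_submul (eps t) (x t) A (a t) (b t) (z t)) ->
  x t =O_[t] g t -> (forall j, j \in A -> a t j * b t j =O_[t] g t) ->
  z t - (x t - \sum_(j in A) a t j * b t j) =O_[t] eps t * g t.
Proof.
move=> h xg abg.
apply: (@bigO_trans _ _ _ _ _ (fun t => eps t * (`|x t| + \sum_(j in A) `|a t j * b t j|))).
  exists (2 ^+ #|I|.+3); first by rewrite exprn_gt0.
  apply: filterS3 eps_ge0 eps_le1 h => t e0 e1 /(fl_submul_err e0 e1).
  by rewrite mulrA.
have norm_bigO f : f t =O_[t] g t -> `|f t| =O_[t] g t.
  by case=> C C0 k; exists C => //; apply: filterS k => t; rewrite normr_id.
apply: bigO_epsM; apply: bigOD; first exact: norm_bigO.
by apply: bigO_sum => [|j /abg]; [exact: bigO_ge0 xg|exact: norm_bigO].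
Qed.

(** The sign of [a] has to be known beforehand, since the root of a negative number is
    unconstrained. *)
Lemma fl_sqrt_bigO (a r : T -> R) : (\forall t \near F, fl_sqrt (eps t) (a t) (r t)) ->
  (\forall t \near F, 0 <= a t) ->
  (\forall t \near F, 0 <= r t) /\ r t ^+ 2 - a t =O_[t] eps t * a t.
Proof.
move=> h a0; split.
  apply: filterS3 h a0 eps_le1 => t h /h[d dle ->] e1.
  by rewrite mulr_ge0 ?sqrtr_ge0 //; move: (ler_norm (- d)); rewrite normrN; lra.
exists 3 => //; apply: filterS3 (filterI eps_ge0 eps_le1) h a0 => t [e0 e1] h a0.
have [d dle ->] := h a0; rewrite exprMn sqr_sqrtr //.
have -> : a t * (1 + d) ^+ 2 - a t = (2 * d + d * d) * a t by ring.
rewrite normrM (ger0_norm a0) mulrA ler_wpM2r //; apply: le_trans (ler_normD _ _) _.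
have h' : `|d * d| <= eps t * 1 by rewrite normrM ler_pM // (le_trans dle).
have h'' : `|2 * d| <= 2 * eps t by rewrite normrM ger0_norm // ler_pM2l.
lra.
Qed.

Lemma fl_quot_bigO (x r z g : T -> R) :
  (\forall t \near F, fl_quot (eps t) (x t) (r t) (z t)) ->
  (\forall t \near F, 0 < r t) -> x t =O_[t] g t ->
  r t * z t - x t =O_[t] eps t * g t.
Proof.
move=> h r0 xg; apply: (@bigO_trans _ _ _ _ _ (fun t => eps t * `|x t|)).
  exists 3 => //; apply: filterS3 (filterI eps_ge0 eps_le1) h r0 => t [e0 e1] h r0.
  by rewrite mulrA; apply: fl_quot_err => //; rewrite gt_eqF.
apply: bigO_epsM; have [C C0 k] := xg.
by exists C => //; apply: filterS k => t; rewrite normr_id.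
Qed.

(** |u|^2 - |v|^2 is the inner product of u - v with (u - v) + 2 v. *)
Lemma vbigO_dot_sub n (u v : T -> 'cV[R]_n) f g :
  (\forall t \near F, 0 <= f t) -> (\forall t \near F, 0 <= g t) ->
  vbigO (fun t => u t - v t) f -> vbigO v g -> f t =O_[t] g t ->
  dot (u t) (u t) - dot (v t) (v t) =O_[t] f t * g t.
Proof.
move=> f0 g0 uv vg fg.
apply: (@bigO_eq _ _ _ _ _ (fun t =>
  \sum_i (u t - v t) i 0 * ((u t - v t) i 0 + (v t i 0 + v t i 0)))) => [t|].
  by rewrite -sumrB; apply: eq_bigr => i _; rewrite !mxE; ring.
apply: bigO_sum => [|i _]; first by apply: filterS2 f0 g0 => t; exact: mulr_ge0.
apply: bigOM; first exact: uv.
by do 2 ?apply: bigOD => //; exact: bigO_trans fg.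
Qed.

(** Here [g] is the known size of [w] to first order, and [a] approximates |w|^2 however it was
    computed. Eventually [a] is at least g^2/2, so the square root does not break down and [r] is at
    least a fixed multiple of [g]. *)
Lemma normalize_bigO n (w q : T -> 'cV[R]_n) (a r g : T -> R) :
  (\forall t \near F, fl_sqrt (eps t) (a t) (r t)) ->
  (\forall t \near F, forall i, fl_quot (eps t) (w t i 0) (r t) (q t i 0)) ->
  a t - dot (w t) (w t) =O_[t] eps t * g t ^+ 2 ->
  dot (w t) (w t) - g t ^+ 2 =o_[t] g t ^+ 2 ->
  (\forall t \near F, 0 < g t) ->
  [/\ \forall t \near F, 0 < r t, g t =O_[t] r t,
      vbigO (fun t => r t *: q t - w t) (fun t => eps t * g t)
    & dot (q t) (q t) - 1 =O_[t] eps t].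
Proof.
move=> hr hq aw wg g0.
have g0' : \forall t \near F, 0 <= g t by apply: filterS g0 => t /ltW.
have gg0 : \forall t \near F, 0 <= g t ^+ 2 by apply: nearW => t; exact: sqr_ge0.
have awo : a t - dot (w t) (w t) =o_[t] g t ^+ 2.
  exact: bigO_littleo_trans aw (eps_littleo gg0).
have ago : a t - g t ^+ 2 =o_[t] g t ^+ 2.
  by apply: littleo_eq (littleoD awo wg) => t; rewrite addrA subrK.
have a0 : \forall t \near F, 0 <= a t.
  by apply: filterS2 (littleo_equiv ago) gg0 => t; lra.
have [r0 ra] := fl_sqrt_bigO hr a0.
have aO : a t =O_[t] g t ^+ 2.
  apply: (@bigO_eq _ _ _ _ _ (fun t => (a t - g t ^+ 2) + g t ^+ 2)) => [t|].
    by rewrite subrK.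
  by apply: bigOD; [exact: littleo_bigO|exact: bigO_refl].
have rago : r t ^+ 2 - a t =O_[t] eps t * g t ^+ 2 by apply: bigO_trans ra (bigO_epsM aO).
have rgo : r t ^+ 2 - g t ^+ 2 =o_[t] g t ^+ 2.
  apply: littleo_eq (littleoD (bigO_littleo_trans rago (eps_littleo gg0)) ago) => t.
  by rewrite addrA subrK.
have gr2 : g t ^+ 2 =O_[t] r t ^+ 2.
  exists 2 => //; apply: filterS (littleo_equiv rgo) => t.
  by rewrite ger0_norm ?sqr_ge0.
have rpos : \forall t \near F, 0 < r t.
  apply: filterS3 r0 g0 (littleo_equiv rgo) => t r0 g0 h.
  rewrite lt0r r0 andbT; apply/eqP => rE; move: h; rewrite rE expr0n /= mulr0 leNgt.
  by rewrite exprn_gt0.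
have gr : g t =O_[t] r t by apply: bigO_sqr gr2.
have ww : dot (w t) (w t) =O_[t] g t ^+ 2.
  apply: (@bigO_eq _ _ _ _ _ (fun t => (dot (w t) (w t) - g t ^+ 2) + g t ^+ 2)) => [t|].
    by rewrite subrK.
  by apply: bigOD; [exact: littleo_bigO|exact: bigO_refl].
have wO : vbigO w g.
  apply: (vbigO_trans (vbigO_norm2 _)); apply: bigO_sqr => //.
  by apply: bigO_eq ww => t; rewrite sqr_norm2.
have rq : vbigO (fun t => r t *: q t - w t) (fun t => eps t * g t).
  move=> i; apply: (@bigO_eq _ _ _ _ _ (fun t => r t * q t i 0 - w t i 0)) => [t|].
    by rewrite !mxE.
  by apply: fl_quot_bigO => //; apply: filterS hq => t; exact.
(* Multiplied by r^2, the defect |q|^2 - 1 is (|r q|^2 - |w|^2) - (a - |w|^2) - (r^2 - a), where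
   each difference is O(eps g^2). *)
split=> //; apply: (bigO_cancel (r := fun t => r t ^+ 2)).
  by apply: filterS rpos => t; exact: exprn_gt0.
apply: (bigO_trans _ (bigO_epsM gr2)).
apply: (@bigO_eq _ _ _ _ _ (fun t => (dot (r t *: q t) (r t *: q t) - dot (w t) (w t))
  - (a t - dot (w t) (w t)) - (r t ^+ 2 - a t))) => [t|].
  by rewrite dotZl dotZr; ring.
do 2 ?apply: bigOB => //.
apply: (@bigO_trans _ _ _ _ _ (fun t => (eps t * g t) * g t)).
  apply: vbigO_dot_sub => //; first by apply: filterS2 eps_ge0 g0' => t; exact: mulr_ge0.
  exact: eps_bigO.
apply: (@bigO_eq _ _ _ _ _ (fun t => eps t * g t ^+ 2)) => [t|]; first by ring.
by apply: bigO_refl; apply: filterS2 eps_ge0 gg0 => t; exact: mulr_ge0.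
Qed.

End ErrorAnalysis.

(** * Distance of a column to the span of the previous ones *)

Section Distance.
Variables (R : realType) (m p : nat).

(** Back substitution on the leading block of size [n]: a multiple of its last column cancels the
    last entry of [s], and the induction hypothesis solves for the rest. *)
Lemma triangular_solve (Rf : 'M[R]_p) (n : nat) (s : 'cV[R]_p) :
  upper_triangular Rf -> (forall j : 'I_p, (j < n)%N -> Rf j j != 0) ->
  (forall j : 'I_p, (n <= j)%N -> s j 0 = 0) ->
  exists2 u, Rf *m u = s & forall j : 'I_p, (n <= j)%N -> u j 0 = 0.
Proof.
move=> upR; elim: n s => [|n IH] s diagR s0.
  exists 0; last by move=> j _; rewrite mxE.
  by rewrite mulmx0; apply/matrixP => j o; rewrite ord1 mxE s0.
have [pn|np] := leqP p n.
  (* There is no index [n], so the support of [s] already fits the smaller block. *)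
  have [||u uE u0] := IH s; first by move=> j jn; apply: diagR; exact: ltnW.
    by move=> j /(leq_trans pn); rewrite leqNgt ltn_ord.
  by exists u => // j /ltnW; exact: u0.
pose k := Ordinal np; pose a := s k 0 / Rf k k.
have [||u uE u0] := IH (s - a *: col k Rf).
- by move=> j jn; apply: diagR; exact: ltnW.
- move=> j; rewrite leq_eqVlt !mxE => /orP[/eqP kj|nj].
    have -> : j = k by apply: val_inj.
    by rewrite mulfVK ?subrr // diagR.
  by rewrite s0 // upR // mulr0 subr0.
exists (u + a *: delta_mx k 0).
  by rewrite mulmxDr uE -scalemxAr -colE subrK.
move=> j nj; rewrite !mxE u0 ?(ltnW nj) // add0r eqxx andbT.
by rewrite -(inj_eq val_inj) /= gtn_eqF ?mulr0.
Qed.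

(* With [s = Rf u], the vector [x_k - Q s] is [X (e_k - u)] up to the residual
   of the first columns, and [e_k - u] has norm at least one. *)
Lemma distance_lower_bound (sigma : R) (X Q : 'M[R]_(m, p)) (Rf : 'M[R]_p)
    (k : 'I_p) (s : 'cV[R]_p) :
  0 <= sigma -> (forall c, sigma * norm2 c <= norm2 (X *m c)) ->
  upper_triangular Rf -> (forall j : 'I_p, (j < k)%N -> Rf j j != 0) ->
  2 * (\sum_i \sum_(l in before k) `|(X - Q *m Rf) i l|) <= sigma ->
  (forall j : 'I_p, (k <= j)%N -> s j 0 = 0) ->
  sigma <= 2 * \sum_i `|(col k X - Q *m s) i 0|.
Proof.
move=> sg0 sX upR diagR D_le s0.
have [u uE u0] := triangular_solve upR diagR s0.
set D := X - Q *m Rf in D_le.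
pose c : 'cV[R]_p := delta_mx k 0 - u.
have c1 : 1 <= norm2 c.
  apply: le_trans (ler_coord_norm2 c k).
  by rewrite !mxE !eqxx u0 // subr0 normr1.
have cu (l : 'I_p) : (l < k)%N -> `|u l 0| <= norm2 c.
  move=> lk; apply: le_trans (ler_coord_norm2 c l); rewrite !mxE.
  by rewrite -(inj_eq val_inj) /= ltn_eqF // add0r normrN.
(* X u = Q s + D u, and [u] vanishes from [k] on, so only the residuals of the previous columns
   enter. *)
have XcE i : (X *m c) i 0 = (col k X - Q *m s) i 0 - \sum_(l in before k) D i l * u l 0.
  have -> : \sum_(l in before k) D i l * u l 0 = (D *m u) i 0.
    rewrite mxE [RHS](bigID (fun l => l \in before k)) /= [X in _ = _ + X]big1 ?addr0 // => l.
    by rewrite inE -leqNgt => /u0 ->; rewrite mulr0.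
  rewrite mulmxBl -mulmxA uE mulmxBr -colE !mxE; ring.
(* The residual term is at most (sigma/2) |c|, which leaves sigma/2 times |c| >= 1 on the other
   side. *)
have := le_trans (sX c) (ler_norm2_sum _).
have : \sum_i `|(X *m c) i 0| <= \sum_i `|(col k X - Q *m s) i 0|
    + (\sum_i \sum_(l in before k) `|D i l|) * norm2 c.
  rewrite mulr_suml -big_split; apply: ler_sum => i _ /=.
  rewrite XcE; apply: le_trans (ler_normB _ _) _; rewrite lerD2l.
  apply: le_trans (ler_norm_sum _ _ _) _; rewrite mulr_suml.
  apply: ler_sum => l; rewrite inE => lk.
  by rewrite normrM ler_wpM2l // cu.
have : 2 * (\sum_i \sum_(l in before k) `|D i l|) * norm2 c <= sigma * norm2 c.
  by rewrite ler_wpM2r ?norm2_ge0.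
have : sigma * 1 <= sigma * norm2 c by rewrite ler_wpM2l.
lra.
Qed.

End Distance.

(** * One column of the orthogonalization *)

Section Recurrences.
Context {R : realType} {T : Type} {F : set_system T} {FF : Filter F}.
Variables (m p : nat) (eps : T -> R) (Q : T -> 'M[R]_(m, p)).

Local Notation "f '=O_[' t ']' g" := (bigO (F := F) (fun t => f) (fun t => g))
  (at level 70, t name, g at next level).
Local Notation "f '=o_[' t ']' g" := (littleo (F := F) (fun t => f) (fun t => g))
  (at level 70, t name, g at next level).

Hypotheses (eps_gt0 : \forall t \near F, 0 < eps t) (eps_o1 : eps t =o_[t] 1).

Let ge01 : \forall t \near F, 0 <= (1 : R).
Proof. exact: nearW. Qed.

(** The product of Q_{k-1} with [tau], without forming a matrix whose width depends on [k]. *)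
Definition combination (k : 'I_p) (Q : 'M[R]_(m, p)) (tau : 'I_p -> R) :=
  \sum_(j in before k) tau j *: col j Q.

Definition orthonormal_before (k : 'I_p) := forall i j : 'I_p,
  (i < k)%N -> (j < k)%N ->
  dot (col i (Q t)) (col j (Q t)) - (i == j)%:R =O_[t] eps t.

Lemma orthonormal_vbigO (q : T -> 'cV[R]_m) :
  dot (q t) (q t) - 1 =O_[t] eps t -> vbigO (F := F) q (fun=> 1).
Proof.
move=> qq; apply: (vbigO_trans (vbigO_norm2 _)); apply: bigO_sqr => //.
apply: (@bigO_eq _ _ _ _ _ (fun t => (dot (q t) (q t) - 1) + 1)) => [t|].
  by rewrite sqr_norm2 subrK.
rewrite expr1n; apply: bigOD; last exact: bigO_cst.
exact: bigO_trans qq (littleo_bigO eps_o1).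
Qed.

Lemma dot_combination (k : 'I_p) (Q' : 'M[R]_(m, p)) tau z :
  dot z (combination k Q' tau) = \sum_(j in before k) tau j * dot z (col j Q').
Proof.
rewrite /dot; under [RHS]eq_bigr do rewrite mulr_sumr.
rewrite exchange_big; apply: eq_bigr => i _; rewrite summxE mulr_sumr.
by apply: eq_bigr => j _; rewrite mxE mulrCA.
Qed.

(** * The rounded update u - Q_{k-1} tau, common to both passes *)

Section Update.
Variables (k : 'I_p) (u w : T -> 'cV[R]_m) (tau : T -> 'I_p -> R) (g : T -> R).
Hypothesis upd : \forall t \near F, forall i,
  fl_submul (eps t) (u t i 0) (before k) (Q t i) (tau t) (w t i 0).
Hypothesis Qk : orthonormal_before k.
Hypotheses (ug : vbigO (F := F) u g) (g0 : \forall t \near F, 0 <= g t).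
Hypothesis tau_g : forall j : 'I_p, (j < k)%N -> tau t j =O_[t] g t.

Let eg0 : \forall t \near F, 0 <= eps t * g t.
Proof. by apply: filterS2 eps_gt0 g0 => t /ltW; exact: mulr_ge0. Qed.

Lemma vbigO_before (j : 'I_p) : (j < k)%N -> vbigO (F := F) (fun t => col j (Q t)) (fun=> 1).
Proof.
move=> jk; apply: orthonormal_vbigO.
by have := Qk jk jk; rewrite eqxx.
Qed.

Lemma update_bigO :
  vbigO (F := F) (fun t => w t - (u t - combination k (Q t) (tau t))) (fun t => eps t * g t).
Proof.
move=> i; apply: (@bigO_eq _ _ _ _ _ (fun t =>
  w t i 0 - (u t i 0 - \sum_(j in before k) Q t i j * tau t j))) => [t|].
  rewrite /combination !mxE summxE; congr (_ - (_ - _)).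
  by apply: eq_bigr => j _; rewrite !mxE mulrC.
apply: (fl_submul_bigO eps_gt0 eps_o1) => [|//|j].
  by apply: filterS upd => t; exact.
rewrite inE => jk; apply: (@bigO_eq _ _ _ _ _ (fun t => col j (Q t) i 0 * tau t j)) => [t|].
  by rewrite mxE.
by apply: bigO_eqr (bigOM (vbigO_before jk i) (tau_g jk)) => t; rewrite mul1r.
Qed.

Lemma dot_update (z : T -> 'cV[R]_m) (h : T -> R) : (\forall t \near F, 0 <= h t) ->
  vbigO (F := F) z h ->
  dot (z t) (w t) - (dot (z t) (u t) - \sum_(j in before k) tau t j * dot (z t) (col j (Q t)))
    =O_[t] eps t * (h t * g t).
Proof.
move=> h0 zh.
apply: (bigO_eqr (g := fun t => h t * (eps t * g t))) => [t|]; first by rewrite mulrCA.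
apply: bigO_eq (dot_bigO h0 eg0 zh update_bigO) => t; rewrite -dot_combination.
by rewrite -scaleN1r -[u t - _]addrC -(scaleN1r (combination _ _ _)) !(dotDr, dotZr); ring.
Qed.

(** By near orthonormality the sum over the previous columns collapses to the coefficient of index
    [j]; the Gram defects cost O(eps g), like the rounding errors. *)
Lemma dot_update_before (j : 'I_p) : (j < k)%N ->
  dot (col j (Q t)) (w t) - (dot (col j (Q t)) (u t) - tau t j) =O_[t] eps t * g t.
Proof.
move=> jk; apply: (@bigO_eq _ _ _ _ _ (fun t =>
  (dot (col j (Q t)) (w t) - (dot (col j (Q t)) (u t)
    - \sum_(l in before k) tau t l * dot (col j (Q t)) (col l (Q t))))
  - \sum_(l in before k) tau t l * (dot (col j (Q t)) (col l (Q t)) - (j == l)%:R))) => [t|].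
  under [X in _ = _ - X]eq_bigr do rewrite mulrBr.
  rewrite sumrB [X in _ = _ - (_ - X)](bigD1 j) ?inE //= eqxx mulr1.
  rewrite [X in _ - (_ - (_ + X))]big1 => [|l /andP[_ lj]].
    by ring.
  by rewrite eq_sym (negPf lj) mulr0.
apply: bigOB.
  by apply: bigO_eqr (dot_update ge01 (vbigO_before jk)) => t; rewrite mul1r.
apply: bigO_sum => // l; rewrite inE => lk.
by apply: bigO_eqr (bigOM (tau_g lk) (Qk jk lk)) => t; rewrite mulrC.
Qed.

Lemma update_vbigO : vbigO (F := F) w g.
Proof.
move=> i; apply: (@bigO_eq _ _ _ _ _ (fun t => (w t - (u t - combination k (Q t) (tau t))) i 0
   + (u t i 0 - \sum_(j in before k) tau t j * col j (Q t) i 0))) => [t|].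
  have -> : (w t - (u t - combination k (Q t) (tau t))) i 0
      = w t i 0 - (u t i 0 - \sum_(j in before k) tau t j * col j (Q t) i 0).
    by rewrite 3!mxE [in LHS]mxE summxE; under eq_bigr do rewrite mxE.
  by ring.
apply: bigOD; first exact: (bigO_eps eps_gt0 eps_o1 (update_bigO i)).
apply: bigOB => //; apply: bigO_sum => // j; rewrite inE => jk.
by apply: bigO_eqr (bigOM (tau_g jk) (vbigO_before jk i)) => t; rewrite mulr1.
Qed.

End Update.

End Recurrences.

(** * Induction on the columns, for all variants at once *)

Section Orthogonalization.
Context {R : realType} {T : Type} {F : set_system T} {FF : Filter F}.
Variables (m p : nat) (eps : T -> R) (beta : R).
Variables (X Q V W : T -> 'M[R]_(m, p)) (S Y Rf : T -> 'M[R]_p) (sigma : T -> R).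

Local Notation "f '=O_[' t ']' g" := (bigO (F := F) (fun t => f) (fun t => g))
  (at level 70, t name, g at next level).
Local Notation "f '=o_[' t ']' g" := (littleo (F := F) (fun t => f) (fun t => g))
  (at level 70, t name, g at next level).

Hypotheses (eps_gt0 : \forall t \near F, 0 < eps t) (eps_o1 : eps t =o_[t] 1).
Hypothesis beta_ge0 : 0 <= beta.

Let x k t := col k (X t).
Let q k t := col k (Q t).
Let v k t := col k (V t).
Let w k t := col k (W t).
Let nx k t := norm2 (x k t).
Let nv k t := norm2 (v k t).

Hypotheses (sigma_gt0 : \forall t \near F, 0 < sigma t)
  (sigmaX : \forall t \near F, forall c, sigma t * norm2 c <= norm2 (X t *m c))
  (eps_sigma : forall k, eps t * nx k t =o_[t] sigma t).

Hypothesis upR : \forall t \near F, upper_triangular (Rf t).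
Hypothesis init : forall k : 'I_p, k = 0%N :> nat ->
  \forall t \near F, fl_IO (eps t) (x k t) (q k t) (Rf t k k).
Hypothesis updV : forall k : 'I_p, (0 < k)%N ->
  \forall t \near F, fl_update (eps t) (X t) (Q t) (S t) (V t) k.
Hypothesis updW : forall k : 'I_p, (0 < k)%N ->
  \forall t \near F, fl_update (eps t) (V t) (Q t) (Y t) (W t) k.
Hypothesis colR : forall k : 'I_p, (0 < k)%N ->
  \forall t \near F, fl_Rcol (eps t) (S t) (Y t) (Rf t) k.
Hypothesis projY : forall k j : 'I_p, (0 < k)%N -> (j < k)%N ->
  \forall t \near F, fl_batched (eps t) beta (q j t) (v k t) (Y t j k).
Hypothesis quotW : forall k : 'I_p, (0 < k)%N ->
  \forall t \near F, forall i, fl_quot (eps t) (W t i k) (Y t k k) (Q t i k).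
(** The norm of w_k for 3S, the Cholesky root for 2S and 1S; the alternative is the same for all
    runs of the filter. *)
Hypothesis normW : forall k : 'I_p, (0 < k)%N ->
  (\forall t \near F, exists2 a,
     fl_inner (eps t) (w k t) (w k t) a & fl_sqrt (eps t) a (Y t k k)) \/
  (\forall t \near F, exists Omega a : R,
     [/\ fl_batched (eps t) beta (v k t) (v k t) Omega,
         fl_submul (eps t) Omega (before k) ((Y t)^~ k) ((Y t)^~ k) a
       & fl_sqrt (eps t) a (Y t k k)]).
(** Delayed products concern the columns of index at least 2; [l] is the step that computed them. *)
Hypothesis projS : forall k : 'I_p, (0 < k)%N ->
  (\forall t \near F, fl_S_direct (eps t) (X t) (Q t) (S t) k) \/
  (exists l : 'I_p, [/\ (0 < l)%N, k = l.+1 :> nat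
     & \forall t \near F, fl_S_delayed (eps t) beta (X t) (Q t) (V t) (Y t) (S t) l k]).

(** Intermediate results given run by run become functions of the run, to which Landau relations
    apply; [u0] is a default for the runs without a witness. *)
Lemma near_choice (U : Type) (u0 : U) (P : T -> U -> Prop) :
  (\forall t \near F, exists u, P t u) ->
  exists u : T -> U, \forall t \near F, P t (u t).
Proof.
move=> h.
have [u uP] : {u : T -> U & forall t, (exists y, P t y) -> P t (u t)}.
  apply: (@choice _ _ (fun t y => (exists z, P t z) -> P t y)) => t.
  have [[y Py]|nP] := pselect (exists y, P t y).
    by exists y.
  by exists u0 => /nP.
by exists u; apply: filterS h => t; exact: uP.
Qed.

(** Besides the two final estimates, the nonzero pivot is carried along: the distance bound solves a
    triangular system with [Rf]. *)
Definition column_accurate (k : 'I_p) :=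
  [/\ forall j : 'I_p, (j <= k)%N -> dot (q j t) (q k t) - (j == k)%:R =O_[t] eps t,
      \forall t \near F, Rf t k k != 0
    & vbigO (F := F) (fun t => col k (X t - Q t *m Rf t)) (fun t => eps t * nx k t)].

(** What the delayed product of the next column needs to know about the second pass on column
    [k]. *)
Definition column_normalized (k : 'I_p) :=
  [/\ \forall t \near F, 0 < Y t k k, nv k t =O_[t] Y t k k,
      vbigO (F := F) (fun t => Y t k k *: q k t - w k t) (fun t => eps t * nv k t)
    & forall j : 'I_p, (j < k)%N -> Y t j k =O_[t] nv k t].

Definition column_ok k := column_accurate k /\ ((0 < k)%N -> column_normalized k).

Let nx0 k : \forall t \near F, 0 <= nx k t.
Proof. by apply: nearW => t; exact: norm2_ge0. Qed.

Let nv0 k : \forall t \near F, 0 <= nv k t.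
Proof. by apply: nearW => t; exact: norm2_ge0. Qed.

Let eps0 : \forall t \near F, 0 <= eps t.
Proof. exact: eps_ge0. Qed.

Let ge0M (f g : T -> R) : (\forall t \near F, 0 <= f t) ->
  (\forall t \near F, 0 <= g t) -> \forall t \near F, 0 <= f t * g t.
Proof. by move=> f0 g0; apply: filterS2 f0 g0 => t; exact: mulr_ge0. Qed.

Lemma near_orthonormal (k : 'I_p) : (forall j : 'I_p, (j < k)%N -> column_accurate j) ->
  orthonormal_before (F := F) eps Q k.
Proof.
move=> ok i j ik jk; have [ij|/ltnW ji] := leqP i j.
  by have [h _ _] := ok j jk; exact: h.
have [h _ _] := ok i ik; apply: bigO_eq (h _ ji) => t.
by rewrite dotC eq_sym.
Qed.

Section PreviousColumns.
Variable k : 'I_p.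
Hypothesis ok : forall j : 'I_p, (j < k)%N -> column_ok j.

Let Qk : orthonormal_before (F := F) eps Q k.
Proof. by apply: near_orthonormal => j /ok[]. Qed.

Let qO (j : 'I_p) : (j < k)%N -> vbigO (F := F) (q j) (fun=> 1).
Proof. exact: (vbigO_before eps_o1 Qk). Qed.

Let norm2_qO (j : 'I_p) : (j < k)%N -> norm2 (q j t) =O_[t] 1.
Proof. by move=> jk; apply: norm2_bigO (qO jk); exact: nearW. Qed.

Lemma batched_proj_bigO (j : 'I_p) (u : T -> 'cV[R]_m) (z : T -> R) : (j < k)%N ->
  (\forall t \near F, fl_batched (eps t) beta (q j t) (u t) (z t)) ->
  z t - dot (q j t) (u t) =O_[t] eps t * norm2 (u t).
Proof.
move=> jk /(fl_batched_bigO eps_gt0 eps_o1 beta_ge0) h; apply: bigO_trans h _.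
apply: bigO_epsM => //; apply: bigO_eqr (bigOM (norm2_qO jk) (bigO_refl _)) => [t|].
  by rewrite mul1r.
by apply: nearW => t; exact: norm2_ge0.
Qed.

Lemma proj_bigO (j : 'I_p) (u : T -> 'cV[R]_m) (z : T -> R) : (j < k)%N ->
  z t - dot (q j t) (u t) =O_[t] eps t * norm2 (u t) -> z t =O_[t] norm2 (u t).
Proof.
move=> jk h; have u0 : \forall t \near F, 0 <= norm2 (u t).
  by apply: nearW => t; exact: norm2_ge0.
apply: (@bigO_eq _ _ _ _ _ (fun t => (z t - dot (q j t) (u t)) + dot (q j t) (u t))) => [t|].
  by rewrite subrK.
apply: bigOD; first exact: bigO_eps h u0.
have ge01 : \forall t \near F, 0 <= (1 : R) by exact: nearW.
apply: bigO_eqr (dot_bigO ge01 u0 (qO jk) (vbigO_norm2 u)) => t.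
by rewrite mul1r.
Qed.

Lemma update_entries (A B : T -> 'M[R]_(m, p)) (C : T -> 'M[R]_p) :
  (\forall t \near F, fl_update (eps t) (A t) (Q t) (C t) (B t) k) ->
  \forall t \near F, forall i,
    fl_submul (eps t) (col k (A t) i 0) (before k) (Q t i) ((C t)^~ k) (col k (B t) i 0).
Proof. by apply: filterS => t h i; rewrite !mxE; exact: h. Qed.

End PreviousColumns.

(** For j < l the entry is a batched product. For j = l the computed quotient is compared with q_l^T
    x_k after multiplication by the pivot Y_ll, through w_l^T x_k. *)
Lemma delayed_proj_bigO (l k : 'I_p) : (0 < l)%N -> k = l.+1 :> nat ->
  (forall j : 'I_p, (j < k)%N -> column_ok j) ->
  (\forall t \near F, fl_S_delayed (eps t) beta (X t) (Q t) (V t) (Y t) (S t) l k) ->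
  forall j : 'I_p, (j < k)%N -> S t j k - dot (q j t) (x k t) =O_[t] eps t * nx k t.
Proof.
move=> l0 kl ok /(near_choice (fun=> 0))[Z] /(near_choice 0)[P] /(near_choice 0)[b h] j.
have lk : (l < k)%N by rewrite kl.
have okl (i : 'I_p) : (i < l)%N -> column_ok i by move=> il; apply: ok; exact: ltn_trans lk.
have Ql : orthonormal_before (F := F) eps Q l by apply: near_orthonormal => i /okl[].
have [_ /(_ l0)[r0 vr rq yO]] := ok l lk.
have hZ (i : 'I_p) : (i < l)%N -> Z t i - dot (q i t) (x k t) =O_[t] eps t * nx k t.
  move=> il; apply: (batched_proj_bigO okl il).
  by apply: filterS h => t [+ _ _ _ _]; exact.
rewrite kl ltnS leq_eqVlt => /orP[/eqP jl|jl]; last first.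
  apply: bigO_near (hZ j jl); apply: filterS h => t [_ _ /(_ j jl) + _ _].
  by rewrite /fun_of_matrix /= => ->.
have {j jl} -> : j = l by exact: val_inj.
have ZO (i : 'I_p) : (i < l)%N -> Z t i =O_[t] nx k t.
  by move=> il; exact: (proj_bigO okl il (hZ i il)).
pose g t := nv l t * nx k t.
have g0 : \forall t \near F, 0 <= g t by exact: ge0M.
have eg0 : \forall t \near F, 0 <= eps t * g t by exact: ge0M.
have hP : P t - dot (v l t) (x k t) =O_[t] eps t * g t.
  by apply: (fl_batched_bigO eps_gt0 eps_o1 beta_ge0); apply: filterS h => t [].
have PO : P t =O_[t] g t.
  apply: (@bigO_eq _ _ _ _ _ (fun t =>
    (P t - dot (v l t) (x k t)) + dot (v l t) (x k t))) => [t|].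
    by rewrite subrK.
  apply: bigOD; first exact: bigO_eps hP g0.
  by apply: dot_bigO => //; exact: vbigO_norm2.
have hb : b t - (P t - \sum_(j in before l) Y t j l * Z t j) =O_[t] eps t * g t.
  apply: (fl_submul_bigO eps_gt0 eps_o1) PO _; first by apply: filterS h => t [].
  by move=> i; rewrite inE => il; apply: bigOM; [exact: yO|exact: ZO].
have uW := update_entries (updW l0).
have wO : vbigO (F := F) (w l) (nv l).
  exact: (update_vbigO eps_gt0 eps_o1 uW Ql (vbigO_norm2 _) (nv0 l) yO).
have hw : dot (x k t) (w l t) - (dot (x k t) (v l t)
    - \sum_(j in before l) Y t j l * dot (x k t) (q j t)) =O_[t] eps t * g t.
  apply: bigO_eqr (dot_update eps_gt0 eps_o1 uW Ql (vbigO_norm2 _) (nv0 l) yO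
    (nx0 k) (vbigO_norm2 _)) => t.
  by rewrite [nx k t * _]mulrC.
(* [P] and [Z] approximate v_l^T x_k and q_j^T x_k, so [b] follows the formula of w_l tested against
   x_k. *)
have bw : b t - dot (x k t) (w l t) =O_[t] eps t * g t.
  apply: (@bigO_eq _ _ _ _ _ (fun t =>
    (b t - (P t - \sum_(j in before l) Y t j l * Z t j)) + (P t - dot (v l t) (x k t))
    - \sum_(j in before l) Y t j l * (Z t j - dot (q j t) (x k t))
    - (dot (x k t) (w l t) - (dot (x k t) (v l t)
       - \sum_(j in before l) Y t j l * dot (x k t) (q j t))))) => [t|].
    under [X in _ = _ - X - _]eq_bigr do rewrite mulrBr dotC.
    by rewrite sumrB (dotC (v l t)); ring.
  do 2 ?apply: bigOB => //; first exact: bigOD.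
  apply: bigO_sum => // i; rewrite inE => il.
  by apply: bigO_eqr (bigOM (yO i il) (hZ i il)) => t; rewrite mulrCA.
have bO : b t =O_[t] g t.
  apply: (@bigO_eq _ _ _ _ _ (fun t =>
    (b t - dot (x k t) (w l t)) + dot (x k t) (w l t))) => [t|].
    by rewrite subrK.
  apply: bigOD; first exact: bigO_eps bw g0.
  apply: (bigO_eqr (g := fun t => nx k t * nv l t)) => [t|]; first by rewrite /g mulrC.
  by apply: dot_bigO => //; exact: vbigO_norm2.
have hr : Y t l l * S t l k - b t =O_[t] eps t * g t.
  by apply: fl_quot_bigO => //; apply: filterS h => t [].
(* Dividing by the pivot turns O(eps |v_l| |x_k|) into O(eps |x_k|), because |v_l| = O(Y_ll). *)
apply: (bigO_cancel r0).
have egr : eps t * g t =O_[t] eps t * nx k t * Y t l l.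
  apply: bigO_eqr (bigO_epsM eps_gt0 (bigOM vr (bigO_refl (nx0 k)))) => t.
  by rewrite -mulrA [nx k t * _]mulrC.
apply: bigO_trans egr.
apply: (@bigO_eq _ _ _ _ _ (fun t => (Y t l l * S t l k - b t) + (b t - dot (x k t) (w l t))
   - dot (x k t) (Y t l l *: q l t - w l t))) => [t|].
  by rewrite -[w l t in RHS]scale1r -scaleNr dotDr !dotZr (dotC (q l t)); ring.
apply: bigOB; first exact: bigOD.
apply: (bigO_eqr (g := fun t => nx k t * (eps t * nv l t))) => [t|].
  by rewrite /g; ring.
by apply: dot_bigO => //; [exact: ge0M|exact: vbigO_norm2].
Qed.

Lemma combinationE (k : 'I_p) (A : 'M[R]_(m, p)) tau i :
  combination k A tau i 0 = \sum_(j in before k) tau j * A i j.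
Proof. by rewrite /combination summxE; apply: eq_bigr => j _; rewrite !mxE. Qed.

Lemma col_residual (A B : 'M[R]_(m, p)) (C : 'M[R]_p) (k : 'I_p) :
  upper_triangular C ->
  col k (A - B *m C) = col k A - combination k B (C^~ k) - C k k *: col k B.
Proof.
move=> upC; apply/matrixP => i o; rewrite ord1 !mxE combinationE.
rewrite (bigID (fun j => j \in before k)) /= [X in - (_ + X)](bigD1 k) ?inE ?ltnn //=.
rewrite [X in _ + (_ + X)]big1 ?addr0 => [|j]; last first.
  rewrite inE -leqNgt => /andP[kj jk]; rewrite upC ?mulr0 //.
  by rewrite ltn_neqAle kj andbT eq_sym; exact: jk.
by under eq_bigr do rewrite mulrC; ring.
Qed.

Lemma nx_gt0 (k : 'I_p) : \forall t \near F, 0 < nx k t.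
Proof.
apply: filterS2 sigma_gt0 sigmaX => t s0 /(_ (delta_mx k 0)).
by rewrite norm2_delta mulr1 -colE; exact: lt_le_trans.
Qed.

Lemma initial_column (k : 'I_p) : k = 0%N :> nat -> column_accurate k.
Proof.
move=> k0; have hIO := init k0.
have [|a ha] := @near_choice R 0 (fun t a =>
    fl_inner (eps t) (x k t) (x k t) a /\ fl_sqrt (eps t) a (Rf t k k)).
  by apply: filterS hIO => t [[a h1 h2] _]; exists a.
(* The scale |x_k| is exactly the norm of the vector being normalized, so the first-order condition
   is trivial. *)
have [||||r0 xr rq qq] := @normalize_bigO _ _ F _ eps eps_gt0 eps_o1 m (x k) (q k) a
    (fun t => Rf t k k) (nx k) _ _ _ _ (nx_gt0 k).
- by apply: filterS ha => t [].
- by apply: filterS hIO => t [].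
- apply: (bigO_eqr (g := fun t => eps t * (norm2 (x k t) * norm2 (x k t)))) => [t|].
    by rewrite expr2.
  apply: (fl_batched_bigO eps_gt0 eps_o1 beta_ge0); apply: fl_inner_batched => //.
  by apply: filterS ha => t [].
- apply: (@littleo_eq _ _ _ _ _ (fun=> 0)) => [t|].
    by rewrite -sqr_norm2 subrr.
  by move=> D; apply: nearW => t; rewrite normr0 mulr0 sqr_ge0.
split; last 1 first.
- move=> i; apply: bigO_near (bigON (rq i)).
  apply: filterS upR => t upt; rewrite col_residual // !mxE combinationE big1 => [|j].
    by ring.
  by rewrite inE k0.
- move=> j; rewrite k0 leqn0 -k0 => /eqP jk.
  have -> : j = k by exact: val_inj.
  by rewrite eqxx.
- by apply: filterS r0 => t; exact: lt0r_neq0.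
Qed.

(** * The two passes on a column, given the previous ones *)

Section NextColumn.
Variable k : 'I_p.
Hypothesis k_gt0 : (0 < k)%N.
Hypothesis ok : forall j : 'I_p, (j < k)%N -> column_ok j.

Let Qk : orthonormal_before (F := F) eps Q k.
Proof. by apply: near_orthonormal => j /ok[]. Qed.

Let qO (j : 'I_p) : (j < k)%N -> vbigO (F := F) (q j) (fun=> 1).
Proof. exact: (vbigO_before eps_o1 Qk). Qed.

Lemma proj_S_bigO (j : 'I_p) : (j < k)%N ->
  S t j k - dot (q j t) (x k t) =O_[t] eps t * nx k t.
Proof.
case: (projS k_gt0) => [h jk|[l [l0 kl h]]]; last exact: delayed_proj_bigO h j.
apply: (batched_proj_bigO ok jk); apply: fl_inner_batched => //.
by apply: filterS h => t; exact.
Qed.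

Let S_O (j : 'I_p) : (j < k)%N -> S t j k =O_[t] nx k t.
Proof. by move=> jk; exact: (proj_bigO ok jk (proj_S_bigO jk)). Qed.

(** The residuals of the previous columns are O(eps |x_l|) = o(sigma), so the smallness condition of
    [distance_lower_bound] eventually holds. *)
Lemma sigma_bigO :
  sigma t =O_[t] norm2 (x k t - combination k (Q t) ((S t)^~ k)).
Proof.
have sg0 : \forall t \near F, 0 <= sigma t by apply: filterS sigma_gt0 => t /ltW.
pose D t := \sum_i \sum_(l in before k) `|(X t - Q t *m Rf t) i l|.
have D_o : D t =o_[t] sigma t.
  apply: littleo_sum => // i _; apply: littleo_sum => // l; rewrite inE => lk.
  have [[_ _ /(_ i) h] _] := ok lk.
  have {}h : col l (X t - Q t *m Rf t) i 0 =o_[t] sigma t.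
    exact: bigO_littleo_trans h (eps_sigma l).
  move=> C; apply: filterS (h C) => t.
  by rewrite mxE normr_id.
have diagR : \forall t \near F, forall j : 'I_p, (j < k)%N -> Rf t j j != 0.
  apply: filter_forall => j; have [jk|kj] := ltnP j k; last exact: nearW.
  by have [[_ h _] _] := ok jk; apply: filterS h => t.
(* 2 from the distance bound, [m] for passing from the sum of coordinates to the norm, 1 for
   positivity. *)
exists (2 * m%:R + 1); first by rewrite ltr_wpDl // mulr_ge0.
apply: filterS3 (filterI sg0 (filterI sigmaX upR)) diagR (D_o 2) => t [s0 [sX uR]] dR Dt.
pose s : 'cV[R]_p := \col_j (if (j < k)%N then S t j k else 0).
have Qs : Q t *m s = combination k (Q t) ((S t)^~ k).
  apply/matrixP => i o; rewrite ord1 combinationE mxE.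
  rewrite (bigID (fun j => j \in before k)) /= addrC big1 ?add0r => [|j].
    by apply: eq_bigr => j; rewrite inE !mxE => ->; rewrite mulrC.
  by rewrite inE !mxE => /negPf ->; rewrite mulr0.
rewrite ger0_norm //.
have Dt' : 2 * D t <= sigma t by apply: le_trans Dt; rewrite ler_pM2l // ler_norm.
have s_supp (j : 'I_p) : (k <= j)%N -> s j 0 = 0 by rewrite mxE ltnNge => ->.
apply: le_trans (distance_lower_bound s0 sX uR dR Dt' s_supp) _.
rewrite Qs; set y := _ - _.
have -> : (2 * m%:R + 1) * norm2 y = 2 * (m%:R * norm2 y) + norm2 y by ring.
rewrite -[leLHS]addr0 lerD ?norm2_ge0 // ler_pM2l //.
have -> : m%:R * norm2 y = \sum_(i < m) norm2 y by rewrite sumr_const card_ord mulr_natl.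
by apply: ler_sum => i _; exact: ler_coord_norm2.
Qed.

Let eo1 : \forall t \near F, 0 <= (1 : R). Proof. exact: nearW. Qed.

Let updVk := update_entries (updV k_gt0).
Let updWk := update_entries (updW k_gt0).

Let vO : vbigO (F := F) (v k) (nx k).
Proof. exact: (update_vbigO eps_gt0 eps_o1 updVk Qk (vbigO_norm2 _) (nx0 k) S_O). Qed.

Let vx : nv k t =O_[t] nx k t.
Proof. exact: norm2_bigO vO. Qed.

Let enx0 : \forall t \near F, 0 <= eps t * nx k t.
Proof. exact: ge0M. Qed.

Let env0 : \forall t \near F, 0 <= eps t * nv k t.
Proof. exact: ge0M. Qed.

(** After the first pass the error is still relative to |x_k|, which may be much larger than
    |v_k|. *)
Lemma dot_qv_bigO (j : 'I_p) : (j < k)%N ->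
  dot (q j t) (v k t) =O_[t] eps t * nx k t.
Proof.
move=> jk; apply: (@bigO_eq _ _ _ _ _ (fun t =>
  (dot (q j t) (v k t) - (dot (q j t) (x k t) - S t j k))
  - (S t j k - dot (q j t) (x k t)))) => [t|].
  by ring.
apply: bigOB; last exact: proj_S_bigO.
exact: (dot_update_before eps_gt0 eps_o1 updVk Qk (vbigO_norm2 _) (nx0 k) S_O jk).
Qed.

(** The rounding errors in v_k are O(eps |x_k|) = o(sigma), hence absorbed in the lower bound for
    the exact difference. *)
Lemma sigma_nv : sigma t =O_[t] nv k t.
Proof.
have sg0 : \forall t \near F, 0 <= sigma t by apply: filterS sigma_gt0 => t /ltW.
apply: (bigO_absorb sg0 _ (eps_sigma k)); apply: bigO_trans sigma_bigO _.
apply: norm2_bigO => [|i].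
  by apply: filterS2 (nv0 k) enx0 => t; exact: addr_ge0.
apply: (@bigO_eq _ _ _ _ _ (fun t => v k t i 0
    - (v k t - (x k t - combination k (Q t) ((S t)^~ k))) i 0)) => [t|].
  by rewrite !mxE; ring.
apply: bigOB; first by apply: bigO_addr => //; exact: vbigO_norm2.
apply: (bigO_eqr (g := fun t => eps t * nx k t + nv k t)) => [t|]; first by rewrite addrC.
apply: bigO_addr => //.
exact: (update_bigO eps_gt0 eps_o1 updVk Qk (vbigO_norm2 _) S_O i).
Qed.

Let nv_gt0 : \forall t \near F, 0 < nv k t.
Proof.
have [C C0 h] := sigma_nv; apply: filterS2 sigma_gt0 h => t s0.
by rewrite gtr0_norm // => h; rewrite -(pmulr_rgt0 _ C0); exact: lt_le_trans h.
Qed.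

Let epsxv : eps t * nx k t =o_[t] nv k t.
Proof. exact: littleo_bigO_trans (eps_sigma k) sigma_nv. Qed.

Let hY (j : 'I_p) : (j < k)%N -> Y t j k - dot (q j t) (v k t) =O_[t] eps t * nv k t.
Proof. by move=> jk; apply: (batched_proj_bigO ok jk); exact: projY. Qed.

(** The second pass is a small correction: its coefficients are O(eps |x_k|) up to rounding, and eps
    |x_k| = o(|v_k|). *)
Let Yo (j : 'I_p) : (j < k)%N -> Y t j k =o_[t] nv k t.
Proof.
move=> jk; apply: (@littleo_eq _ _ _ _ _ (fun t =>
  (Y t j k - dot (q j t) (v k t)) + dot (q j t) (v k t))) => [t|].
  by rewrite subrK.
apply: littleoD; first by apply: bigO_littleo_trans (hY jk) _; exact: eps_littleo.
exact: bigO_littleo_trans (dot_qv_bigO jk) epsxv.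
Qed.

Let YO (j : 'I_p) : (j < k)%N -> Y t j k =O_[t] nv k t.
Proof. by move=> /Yo; exact: littleo_bigO. Qed.

Let updWk_bigO : vbigO (F := F)
  (fun t => w k t - (v k t - combination k (Q t) ((Y t)^~ k))) (fun t => eps t * nv k t).
Proof. exact: (update_bigO eps_gt0 eps_o1 updWk Qk (vbigO_norm2 _) YO). Qed.

(** The gain of the second pass: the errors are now relative to |v_k|. *)
Lemma dot_qw_bigO (j : 'I_p) : (j < k)%N ->
  dot (q j t) (w k t) =O_[t] eps t * nv k t.
Proof.
move=> jk; apply: (@bigO_eq _ _ _ _ _ (fun t =>
  (dot (q j t) (w k t) - (dot (q j t) (v k t) - Y t j k))
  - (Y t j k - dot (q j t) (v k t)))) => [t|].
  by ring.
apply: bigOB; last exact: hY.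
exact: (dot_update_before eps_gt0 eps_o1 updWk Qk (vbigO_norm2 _) (nv0 k) YO jk).
Qed.

Let wO : vbigO (F := F) (w k) (nv k).
Proof. exact: (update_vbigO eps_gt0 eps_o1 updWk Qk (vbigO_norm2 _) (nv0 k) YO). Qed.

Lemma dot_ww_littleo : dot (w k t) (w k t) - nv k t ^+ 2 =o_[t] nv k t ^+ 2.
Proof.
have wv i : (w k t - v k t) i 0 =o_[t] nv k t.
  apply: (@littleo_eq _ _ _ _ _ (fun t =>
    (w k t - (v k t - combination k (Q t) ((Y t)^~ k))) i 0
    + - \sum_(j in before k) Y t j k * q j t i 0)) => [t|].
    have -> : \sum_(j in before k) Y t j k * q j t i 0 = combination k (Q t) ((Y t)^~ k) i 0.
      by rewrite combinationE; apply: eq_bigr => j _; rewrite mxE.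
    by rewrite !mxE; ring.
  apply: littleoD.
    apply: bigO_littleo_trans (updWk_bigO i) _; exact: (eps_littleo eps_o1 (nv0 k)).
  apply: littleoN; apply: littleo_sum => // j; rewrite inE => jk.
  apply: littleo_bigO_trans (littleoM (Yo jk) (qO jk i)) _.
  by apply: (@bigO_eq _ _ _ _ _ (nv k)) => [t|]; [rewrite mulr1|exact: bigO_refl (nv0 k)].
apply: (@littleo_eq _ _ _ _ _ (fun t =>
  \sum_i (w k t - v k t) i 0 * (w k t i 0 + v k t i 0))) => [t|].
  rewrite sqr_norm2 -sumrB; apply: eq_bigr => i _.
  have -> : (w k t - v k t) i 0 = w k t i 0 - v k t i 0 by rewrite !mxE.
  by ring.
apply: littleo_sum => [|i _]; first by apply: nearW => t; exact: sqr_ge0.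
have wvO : w k t i 0 + v k t i 0 =O_[t] nv k t.
  by apply: bigOD; [exact: wO|exact: vbigO_norm2].
apply: littleo_bigO_trans (littleoM (wv i) wvO) _.
apply: (@bigO_eq _ _ _ _ _ (fun t => nv k t ^+ 2)) => [t|]; first by rewrite expr2.
by apply: bigO_refl; apply: nearW => t; exact: sqr_ge0.
Qed.

Let g t := nv k t * nv k t.

(** Up to O(eps |v|^2), w^T w = w^T v as w is nearly orthogonal to the q_j, and v^T w = v^T v -
    sum_j y_j v^T q_j, where v^T q_j may be replaced by y_j. *)
Lemma cholesky_bigO (Omega a : T -> R) :
  (\forall t \near F, fl_batched (eps t) beta (v k t) (v k t) (Omega t)) ->
  (\forall t \near F,
    fl_submul (eps t) (Omega t) (before k) ((Y t)^~ k) ((Y t)^~ k) (a t)) ->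
  a t - dot (w k t) (w k t) =O_[t] eps t * g t.
Proof.
move=> /(fl_batched_bigO eps_gt0 eps_o1 beta_ge0) hO ha.
have g0 : \forall t \near F, 0 <= g t by exact: ge0M.
have eg0 : \forall t \near F, 0 <= eps t * g t by exact: ge0M.
have {}ha : a t - (Omega t - \sum_(j in before k) Y t j k * Y t j k) =O_[t] eps t * g t.
  apply: (fl_submul_bigO eps_gt0 eps_o1 ha) => [|j].
    apply: (@bigO_eq _ _ _ _ _ (fun t =>
    (Omega t - dot (v k t) (v k t)) + dot (v k t) (v k t))) => [t|].
      by rewrite subrK.
    by apply: bigOD; [exact: bigO_eps hO g0|apply: dot_bigO => //; exact: vbigO_norm2].
  by rewrite inE => jk; exact: bigOM (YO jk) (YO jk).
have dot_w (z : T -> 'cV[R]_m) : vbigO (F := F) z (nv k) ->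
    dot (z t) (w k t) - (dot (z t) (v k t)
      - \sum_(j in before k) Y t j k * dot (z t) (q j t)) =O_[t] eps t * g t.
  exact: (dot_update eps_gt0 eps_o1 updWk Qk (vbigO_norm2 _) (nv0 k) YO).
apply: (@bigO_eq _ _ _ _ _ (fun t =>
  (a t - (Omega t - \sum_(j in before k) Y t j k * Y t j k))
  + (Omega t - dot (v k t) (v k t))
  - \sum_(j in before k) Y t j k * (Y t j k - dot (q j t) (v k t))
  - (dot (v k t) (w k t) - (dot (v k t) (v k t)
      - \sum_(j in before k) Y t j k * dot (v k t) (q j t)))
  - (dot (w k t) (w k t) - (dot (w k t) (v k t)
      - \sum_(j in before k) Y t j k * dot (w k t) (q j t)))
  + \sum_(j in before k) Y t j k * dot (w k t) (q j t))) => [t|].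
  under [X in _ = _ + _ - X - _ - _ + _]eq_bigr do rewrite mulrBr dotC.
  by rewrite sumrB (dotC (w k t) (v k t)); ring.
apply: bigOD; last first.
  apply: bigO_sum => // j; rewrite inE => jk.
  apply: (bigO_eqr (g := fun t => nv k t * (eps t * nv k t))) => [t|]; first by rewrite mulrCA.
  by apply: bigO_eq (bigOM (YO jk) (dot_qw_bigO jk)) => t; rewrite dotC.
apply: bigOB; last exact: dot_w.
apply: bigOB; last by apply: dot_w; exact: vbigO_norm2.
apply: bigOB; first exact: bigOD.
apply: bigO_sum => // j; rewrite inE => jk.
by apply: bigO_eqr (bigOM (YO jk) (hY jk)) => t; rewrite mulrCA.
Qed.

Lemma next_column : column_ok k.
Proof.
(* Whichever way the pivot is computed, its radicand [a] is |w_k|^2 up to O(eps |v_k|^2). *)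
have [a [ha aw]] : exists a : T -> R,
    (\forall t \near F, fl_sqrt (eps t) (a t) (Y t k k)) /\
    a t - dot (w k t) (w k t) =O_[t] eps t * g t.
  case: (normW k_gt0) => h.
    have [|a ha] := @near_choice R 0 (fun t a =>
        fl_inner (eps t) (w k t) (w k t) a /\ fl_sqrt (eps t) a (Y t k k)).
      by apply: filterS h => t [a h1 h2]; exists a.
    exists a; split; first by apply: filterS ha => t [].
    have wn : norm2 (w k t) =O_[t] nv k t by exact: norm2_bigO wO.
    apply: bigO_trans (bigO_epsM eps_gt0 (bigOM wn wn)).
    apply: (fl_batched_bigO eps_gt0 eps_o1 beta_ge0); apply: fl_inner_batched => //.
    by apply: filterS ha => t [].
  have [|Oa hOa] := @near_choice (R * R)%type (0, 0) (fun t Oa =>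
      [/\ fl_batched (eps t) beta (v k t) (v k t) Oa.1,
         fl_submul (eps t) Oa.1 (before k) ((Y t)^~ k) ((Y t)^~ k) Oa.2
       & fl_sqrt (eps t) Oa.2 (Y t k k)]).
    by apply: filterS h => t [O [a h]]; exists (O, a).
  exists (fun t => (Oa t).2); split; first by apply: filterS hOa => t [].
  by apply: (@cholesky_bigO (fun t => (Oa t).1)); apply: filterS hOa => t [].
have [||||r0 vr rq qq] := @normalize_bigO _ _ F _ eps eps_gt0 eps_o1 m (w k) (q k) a
    (fun t => Y t k k) (nv k) ha.
- by apply: filterS (quotW k_gt0) => t h i; rewrite !mxE; exact: h.
- by apply: bigO_eqr aw => t; rewrite expr2.
- exact: dot_ww_littleo.
- exact: nv_gt0.
split=> [|_]; last by split=> //; exact: YO.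
have RY : \forall t \near F, Rf t k k = Y t k k by apply: filterS (colR k_gt0) => t [].
split.
- move=> j; rewrite leq_eqVlt => /orP[/eqP jk|jk].
    have -> : j = k by exact: val_inj.
    by rewrite eqxx.
  rewrite -(inj_eq val_inj) /= ltn_eqF //.
  apply: (@bigO_eq _ _ _ _ _ (fun t => dot (q j t) (q k t))) => [t|]; first by rewrite subr0.
  (* Y_kk q_k is w_k up to O(eps |v_k|), and |v_k| = O(Y_kk). *)
  apply: (bigO_cancel r0); apply: bigO_trans (bigO_epsM eps_gt0 vr).
  apply: (@bigO_eq _ _ _ _ _ (fun t => dot (q j t) (w k t)
     + dot (q j t) (Y t k k *: q k t - w k t))) => [t|].
    by rewrite -[w k t in X in _ + X]scale1r -scaleNr dotDr !dotZr; ring.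
  apply: bigOD; first exact: dot_qw_bigO.
  apply: bigO_eqr (dot_bigO eo1 env0 (qO jk) rq) => t; by rewrite mul1r.
- by apply: filterS2 RY r0 => t -> /lt0r_neq0.
have evx : eps t * nv k t =O_[t] eps t * nx k t by exact: bigO_epsM.
(* The residual is the sum of four local errors: forming the column of [Rf], the first update, the
   second update and the normalization. *)
move=> i; apply: (@bigO_near _ _ _ _ _ (fun t =>
   - \sum_(j in before k) q j t i 0 * (Rf t j k - (S t j k + Y t j k))
   - (v k t - (x k t - combination k (Q t) ((S t)^~ k))) i 0
   - (w k t - (v k t - combination k (Q t) ((Y t)^~ k))) i 0
   - (Y t k k *: q k t - w k t) i 0)).
  apply: filterS2 upR RY => t upt RYt; rewrite col_residual // RYt.
  under [X in _ = - X - _ - _ - _]eq_bigr do rewrite mxE mulrBr mulrDr.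
  rewrite sumrB big_split !mxE !combinationE /=.
  do 3![under [\sum_(j in before k) Q t i j * _]eq_bigr do rewrite mulrC].
  by ring.
do 3 ?apply: bigOB.
- apply: bigON; apply: bigO_sum => // j; rewrite inE => jk.
  have SY : S t j k + Y t j k =O_[t] nx k t.
    by apply: bigOD; [exact: S_O|exact: bigO_trans (YO jk) vx].
  have RSY : Rf t j k - (S t j k + Y t j k) =O_[t] eps t * nx k t.
    apply: (fl_bigO eps_gt0 _ SY); apply: filterS (colR k_gt0) => t [+ _].
    exact.
  by apply: bigO_eqr (bigOM (qO jk i) RSY) => t; rewrite mul1r.
- exact: (update_bigO eps_gt0 eps_o1 updVk Qk (vbigO_norm2 _) S_O i).
- exact: bigO_trans (updWk_bigO i) evx.
- exact: bigO_trans (rq i) evx.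
Qed.

End NextColumn.

Lemma all_columns (k : 'I_p) : column_ok k.
Proof.
have [n] := ubnP k; elim: n k => // n IH k; rewrite ltnS => kn.
have [k0|k0] := posnP k.
  by split=> [|]; [exact: initial_column|rewrite k0].
by apply: next_column => // j jk; apply: IH; exact: leq_trans kn.
Qed.

End Orthogonalization.

(** * Uniformity over the runs *)

Section Runs.
Variables (R : realType) (m p : nat) (beta : R).
Hypotheses (p_gt0 : (0 < p)%N) (beta_ge0 : 0 <= beta).

(** [eps] and the matrices all vary with the run, so that constants obtained along a filter on runs
    depend on none of them. *)
Record run := Run {
  run_eps : R; run_X : 'M[R]_(m, p); run_Q : 'M[R]_(m, p); run_Rf : 'M[R]_p;
  run_S : 'M[R]_p; run_Y : 'M[R]_p; run_V : 'M[R]_(m, p); run_W : 'M[R]_(m, p) }.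

(* The flag [delayed] is set for 1S, where the columns of S of index k > 1 come
   from the previous step, and [chol] is set for 2S and 1S. *)
Definition run_spec (delayed chol : bool) (eps : R) (X Q : 'M[R]_(m, p))
    (Rf S Y : 'M[R]_p) (V W : 'M[R]_(m, p)) : Prop :=
  [/\ upper_triangular Rf, fl_init eps X Q Rf
    & forall k : 'I_p, (0 < k)%N ->
      [/\ fl_update eps X Q S V k /\ fl_update eps V Q Y W k,
          fl_Rcol eps S Y Rf k,
          (forall j : 'I_p, (j < k)%N ->
             fl_batched eps beta (col j Q) (col k V) (Y j k)) /\
          (forall i, fl_quot eps (W i k) (Y k k) (Q i k)),
          if chol then
            exists Omega a : R,
            [/\ fl_batched eps beta (col k V) (col k V) Omega,
                fl_submul eps Omega (before k) (Y^~ k) (Y^~ k) a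
              & fl_sqrt eps a (Y k k)]
          else exists2 a, fl_inner eps (col k W) (col k W) a & fl_sqrt eps a (Y k k)
        & if delayed && (1 < k)%N then
            forall l : 'I_p, (0 < l)%N -> k = l.+1 :> nat ->
              fl_S_delayed eps beta X Q V Y S l k
          else fl_S_direct eps X Q S k]].

Definition valid_run (delayed chol : bool) (r : run) : Prop :=
  run_spec delayed chol (run_eps r) (run_X r) (run_Q r) (run_Rf r) (run_S r)
    (run_Y r) (run_V r) (run_W r).

(** The condition c eps kappa <= 1 with full column rank, cleared of its denominator. *)
Definition well_conditioned (r : run) (c : R) :=
  [/\ 0 < run_eps r, 0 < sigma_min (run_X r)
    & c * run_eps r * sigma_max (run_X r) <= sigma_min (run_X r)].

(** A property holds near this filter when one constant [c], common to all runs, makes c eps kappa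
    <= 1 sufficient for it. *)
Definition runs_near (P : run -> Prop) : set_system run :=
  [set A | exists c, forall r, P r -> well_conditioned r c -> A r].

Lemma norm2_col_le_sigma_max (X : 'M[R]_(m, p)) k : norm2 (col k X) <= sigma_max X.
Proof.
have := sigma_max_ge X (delta_mx k 0) p_gt0.
by rewrite -colE norm2_delta mulr1.
Qed.

Lemma sigma_max_ge0 (X : 'M[R]_(m, p)) : 0 <= sigma_max X.
Proof. exact: le_trans (norm2_ge0 _) (norm2_col_le_sigma_max X (Ordinal p_gt0)). Qed.

Lemma sigma_min_le_max (X : 'M[R]_(m, p)) : sigma_min X <= sigma_max X.
Proof.
apply: le_trans (norm2_col_le_sigma_max X (Ordinal p_gt0)).
have := sigma_min_le X (delta_mx (Ordinal p_gt0) 0) p_gt0.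
by rewrite -colE norm2_delta mulr1.
Qed.

Lemma well_conditionedW r c c' : c <= c' ->
  well_conditioned r c' -> well_conditioned r c.
Proof.
move=> cc' [e0 s0 h]; split=> //; apply: le_trans h.
by rewrite ler_wpM2r ?sigma_max_ge0 // ler_wpM2r // ltW.
Qed.

Instance runs_near_filter P : Filter (runs_near P).
Proof.
split; first by exists 0.
  move=> A B [c hc] [d hd]; exists (Num.max c d) => r Pr wr.
  split; [apply: hc|apply: hd] => //; apply: well_conditionedW wr;
    by rewrite le_max lexx ?orbT.
by move=> A B AB [c hc]; exists c => r Pr wr; apply/AB/hc.
Qed.

Lemma runs_near_spec (P A : run -> Prop) : (forall r, P r -> A r) ->
  \forall r \near runs_near P, A r.
Proof. by move=> PA; exists 0 => r /PA. Qed.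

Lemma run_accurate (delayed chol : bool) : exists c1 c2 c3 : R,
  forall r, valid_run delayed chol r -> well_conditioned r c1 ->
    opnorm2 (run_Q r *m run_Rf r - run_X r)
      <= c2 * (run_eps r * opnorm2 (run_X r)) /\
    opnorm2 (1%:M - (run_Q r)^T *m run_Q r) <= c3 * run_eps r.
Proof.
pose F := runs_near (valid_run delayed chol).
have FF : Filter F by exact: runs_near_filter.
have eps_gt0 : \forall r \near F, 0 < run_eps r by exists 0 => r _ [].
have sigma_gt0 : \forall r \near F, 0 < sigma_min (run_X r) by exists 0 => r _ [].
have sigmaX : \forall r \near F, forall c,
    sigma_min (run_X r) * norm2 c <= norm2 (run_X r *m c).
  by apply: nearW => r c; exact: sigma_min_le.
(* As sigma_min <= sigma_max, c eps kappa <= 1 implies c eps <= 1; the absolute value takes care of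
   a negative [C]. *)
have eps_o1 : littleo (F := F) run_eps (fun=> 1).
  move=> C; exists `|C| => r _ [e0 s0 h].
  rewrite -(ler_pM2r s0) mul1r (gtr0_norm e0); apply: le_trans h.
  apply: (@le_trans _ _ (`|C| * run_eps r * sigma_min (run_X r))).
    by rewrite ler_pM2r // ler_pM2r // ler_norm.
  by rewrite ler_wpM2l ?sigma_min_le_max // mulr_ge0 // ltW.
have eps_sigma k : littleo (F := F) (fun r => run_eps r * norm2 (col k (run_X r)))
    (fun r => sigma_min (run_X r)).
  move=> C; exists `|C| => r _ [e0 s0 h]; apply: le_trans h.
  rewrite ger0_norm ?mulr_ge0 ?norm2_ge0 ?(ltW e0) // mulrA.
  apply: (@le_trans _ _ (`|C| * run_eps r * norm2 (col k (run_X r)))).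
    by rewrite ler_wpM2r ?norm2_ge0 // ler_pM2r // ler_norm.
  by rewrite ler_wpM2l ?norm2_col_le_sigma_max // mulr_ge0 // ltW.
have opX0 r : 0 <= opnorm2 (run_X r).
  exact: le_trans (norm2_ge0 _) (norm2_col_le_opnorm2 _ (Ordinal p_gt0)).
have nearP := @runs_near_spec (valid_run delayed chol).
have ok (k : 'I_p) : column_ok (F := F) run_eps run_X run_Q run_V run_W run_Y run_Rf k.
  apply: (all_columns (beta := beta) (S := run_S)
      (sigma := fun r => sigma_min (run_X r))) => //.
  - by apply: nearP => r [].
  - by move=> j j0; apply: nearP => r [_ /(_ j j0)].
  - by move=> j j0; apply: nearP => r [_ _ /(_ j j0)[[]]].
  - by move=> j j0; apply: nearP => r [_ _ /(_ j j0)[[]]].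
  - by move=> j j0; apply: nearP => r [_ _ /(_ j j0)[]].
  - by move=> j i j0 ij; apply: nearP => r [_ _ /(_ j j0)[_ _ [/(_ i ij)]]].
  - by move=> j j0; apply: nearP => r [_ _ /(_ j j0)[_ _ []]].
  (* The alternative is decided by the flag before any run is considered; [F] depends on the flag
     and is generalized with it. *)
  - move=> j j0; case: chol @F FF eps_gt0 sigma_gt0 sigmaX eps_o1 eps_sigma nearP => F *.
      by right; apply: runs_near_spec => r [_ _ /(_ j j0)[]].
    by left; apply: runs_near_spec => r [_ _ /(_ j j0)[]].
  (* The delayed entries of column j come from step j - 1, which is positive since j > 1; column 1
     has a direct product in every variant. *)
  - move=> j j0; have [dj|dj] := boolP (delayed && (1 < j)%N).
      right; have /andP[_ j1] := dj.
      have lj : (j.-1 < p)%N by apply: leq_ltn_trans (ltn_ord j); exact: leq_pred.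
      exists (Ordinal lj); split; [by rewrite /= -ltnS prednK|by rewrite /= prednK|].
      apply: nearP => r [_ _ /(_ j j0)[_ _ _ _]]; rewrite dj; apply.
        by rewrite /= -ltnS prednK.
      by rewrite /= prednK.
    by left; apply: nearP => r [_ _ /(_ j j0)[_ _ _ _]]; rewrite (negPf dj).
have eps0 : \forall r \near F, 0 <= run_eps r by exact: eps_ge0.
have residual : bigO (F := F) (fun r => absum (run_Q r *m run_Rf r - run_X r))
    (fun r => run_eps r * opnorm2 (run_X r)).
  apply: bigO_sum => [|i _].
    by apply: filterS eps0 => r e0; rewrite mulr_ge0.
  apply: bigO_sum => [|k _].
    by apply: filterS eps0 => r e0; rewrite mulr_ge0.
  have [[_ _ /(_ i)[C C0 h]] _] := ok k.
  exists C => //; apply: filterS2 eps0 h => r e0; rewrite mxE -normrN => h; rewrite normr_id.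
  have -> : (run_Q r *m run_Rf r - run_X r) i k = - (run_X r - run_Q r *m run_Rf r) i k.
    by rewrite !mxE opprB.
  by apply: le_trans h _; rewrite ler_pM2l // ler_wpM2l // norm2_col_le_opnorm2.
have orth : bigO (F := F) (fun r => absum (1%:M - (run_Q r)^T *m run_Q r)) run_eps.
  apply: bigO_sum => // i _; apply: bigO_sum => // j _.
  have E r : (1%:M - (run_Q r)^T *m run_Q r) i j
      = - (dot (col i (run_Q r)) (col j (run_Q r)) - (i == j)%:R).
    rewrite opprB !mxE; congr (_ - _); apply: eq_bigr => l _.
    by rewrite !mxE.
  have [C C0 h] : bigO (F := F)
      (fun r => dot (col i (run_Q r)) (col j (run_Q r)) - (i == j)%:R) run_eps.
    have [ij|/ltnW ji] := leqP i j; first by have [[h _ _] _] := ok j; exact: h.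
    have [[h _ _] _] := ok i; apply: bigO_eq (h j ji) => r.
    by rewrite dotC eq_sym.
  by exists C => //; apply: filterS h => r; rewrite normr_id E normrN.
have [c2 _ h2] := residual; have [c3 _ h3] := orth.
(* Unfolding membership in the filter yields the constant [c1]. *)
have [c1 h] : F [set r | opnorm2 (run_Q r *m run_Rf r - run_X r)
      <= c2 * (run_eps r * opnorm2 (run_X r)) /\
    opnorm2 (1%:M - (run_Q r)^T *m run_Q r) <= c3 * run_eps r].
  apply: filterS2 h2 h3 => r h2 h3; split.
    by apply: le_trans (opnorm2_le_absum _ p_gt0) (le_trans (ler_norm _) h2).
  by apply: le_trans (opnorm2_le_absum _ p_gt0) (le_trans (ler_norm _) h3).
by exists c1, c2, c3.
Qed.

(** One plus the sum of the absolute values over the four pairs of flags is positive and dominates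
    each constant; enlarging [c1] strengthens the condition, enlarging the others weakens the
    bounds. *)
Lemma uniform_accuracy : exists c1 c2 c3 : R,
  [/\ 0 < c1, 0 < c2, 0 < c3 &
    forall delayed chol r, valid_run delayed chol r -> well_conditioned r c1 ->
      opnorm2 (run_Q r *m run_Rf r - run_X r) <= c2 * run_eps r * opnorm2 (run_X r) /\
      opnorm2 (1%:M - (run_Q r)^T *m run_Q r) <= c3 * run_eps r].
Proof.
have [c /choice[d /choice[e h]]] : exists c : bool * bool -> R,
    forall b, exists d e : R, forall r, valid_run b.1 b.2 r -> well_conditioned r (c b) ->
    opnorm2 (run_Q r *m run_Rf r - run_X r) <= d * (run_eps r * opnorm2 (run_X r)) /\
    opnorm2 (1%:M - (run_Q r)^T *m run_Q r) <= e * run_eps r.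
  have [c hc] := choice (fun b : bool * bool => run_accurate b.1 b.2).
  by exists c.
have le_tot (f : bool * bool -> R) b : f b <= 1 + \sum_b `|f b|.
  rewrite (bigD1 b) //=; have := ler_norm (f b).
  have : 0 <= \sum_(i | i != b) `|f i| by exact: sumr_ge0.
  lra.
have tot_gt0 (f : bool * bool -> R) : 0 < 1 + \sum_b `|f b|.
  by rewrite ltr_wpDr // sumr_ge0.
exists (1 + \sum_b `|c b|), (1 + \sum_b `|d b|), (1 + \sum_b `|e b|).
split=> // delayed chol r vr wr.
have [|h2 h3] := h (delayed, chol) r vr; first exact: well_conditionedW wr.
have [e0 _ _] := wr.
have X0 : 0 <= opnorm2 (run_X r).
  exact: le_trans (norm2_ge0 _) (norm2_col_le_opnorm2 _ (Ordinal p_gt0)).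
split; first by apply: le_trans h2 _; rewrite -mulrA ler_wpM2r // mulr_ge0 // ltW.
by apply: le_trans h3 _; rewrite ler_wpM2r // ltW.
Qed.

(** * The three variants as instances of [run_spec] *)

Lemma BCGSIA_3S_run eps (X Q : 'M[R]_(m, p)) Rf : 0 < eps -> BCGSIA_3S eps X Q Rf ->
  exists S Y V W, run_spec false false eps X Q Rf S Y V W.
Proof.
move=> e0 [S [Y [V [W [up ini step]]]]]; exists S, Y, V, W; split=> // k k0.
have [hS hV hY [hW [hn hq]] hR] := step k k0.
split=> //; split; last by move=> i; have := hq i; rewrite !mxE.
move=> j jk; exists (Y j k); first exact: hY.
by rewrite subrr normr0 !mulr_ge0 ?norm2_ge0 // ltW.
Qed.

(** Each step provides its own matrix, of which only column [k] matters; these columns are assembled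
    into one matrix. *)
Lemma choose_W eps (Q V : 'M[R]_(m, p)) (Y : 'M[R]_p) :
  (forall k : 'I_p, (0 < k)%N -> fl_cholesky_step eps beta Q V Y k) ->
  exists W, forall k : 'I_p, (0 < k)%N ->
    fl_update eps V Q Y W k /\ forall i, fl_quot eps (W i k) (Y k k) (Q i k).
Proof.
move=> h.
have [W hW] : exists W : 'I_p -> 'M[R]_(m, p), forall k : 'I_p, (0 < k)%N ->
    fl_update eps V Q Y (W k) k /\ forall i, fl_quot eps (W k i k) (Y k k) (Q i k).
  apply: (@fin_all_exists _ (fun=> 'M[R]_(m, p)) (fun (k : 'I_p) W => (0 < k)%N ->
    fl_update eps V Q Y W k /\ forall i, fl_quot eps (W i k) (Y k k) (Q i k))) => k.
  have [k0|k0] := posnP k; first by exists 0.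
  by have [_ _ [W hW hq]] := h k k0; exists W.
exists (\matrix_(i, k) W k i k) => k /hW[hu hq].
by split=> i; rewrite mxE; [exact: hu|exact: hq].
Qed.

Lemma BCGSIA_2S_run eps (X Q : 'M[R]_(m, p)) Rf : BCGSIA_2S eps beta X Q Rf ->
  exists S Y V W, run_spec false true eps X Q Rf S Y V W.
Proof.
move=> [S [Y [V [up ini step]]]].
have [|W hW] := @choose_W eps Q V Y; first by move=> k /step[].
exists S, Y, V, W; split=> // k k0.
by have [hS hV [hY hc _] hR] := step k k0; have [hu hq] := hW k k0.
Qed.

Lemma BCGSIA_1S_run eps (X Q : 'M[R]_(m, p)) Rf : BCGSIA_1S eps beta X Q Rf ->
  exists S Y V W, run_spec true true eps X Q Rf S Y V W.
Proof.
move=> [S [Y [V [up ini hS1 step delayed]]]].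
have [|W hW] := @choose_W eps Q V Y; first by move=> k /step[].
exists S, Y, V, W; split=> // k k0.
have [hV [hY hc _] hR] := step k k0; have [hu hq] := hW k k0.
split=> //; rewrite /=; case: ltnP => k1; first by move=> l l0 kl; exact: delayed.
by apply: hS1; apply/eqP; rewrite eqn_leq k1.
Qed.

End Runs.

(** A zero [sigma_min X] makes the product infinite, so the finite bound excludes it. *)
Lemma kappa_bound (R : realType) m p (X : 'M[R]_(m, p)) (a : R) : 0 < a ->
  (a%:E * kappa X <= (2^-1)%:E)%E ->
  0 < sigma_min X /\ a * sigma_max X <= sigma_min X.
Proof.
move=> a0; rewrite /kappa; case: ifPn => [_|s0].
  by rewrite gt0_muley ?lte_fin // leye_eq.
(* An infimum of nonnegative numbers is nonnegative; the infimum of the empty set is 0 by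
   convention, which is excluded too. *)
have s_gt0 : 0 < sigma_min X.
  rewrite lt0r s0; have [[x hx]|hE] := pselect (singular_values X !=set0).
    by apply: lb_le_inf => [|y []]; first by exists x.
  suff E : singular_values X = set0 by rewrite /sigma_min E inf0 lexx.
  by apply/eqP; apply: contra_notT hE => /set0P.
rewrite -EFinM lee_fin mulrA ler_pdivrMr // => h; split=> //; lra.
Qed.

Theorem corollary1 (R : realType) (m p : nat) (beta : R) :
  (0 < p)%N -> (p <= m)%N -> 0 <= beta ->
  exists c1 c2 c3 : R, [/\ 0 < c1, 0 < c2, 0 < c3 &
    forall (eps : R) (X Q : 'M[R]_(m, p)) (Rf : 'M[R]_p),
      0 < eps ->
      BCGSIA_3S eps X Q Rf \/ BCGSIA_2S eps beta X Q Rf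
        \/ BCGSIA_1S eps beta X Q Rf ->
      ((c1 * eps)%:E * kappa X <= (2^-1)%:E)%E ->
      (exists2 dX : 'M[R]_(m, p),
          X + dX = Q *m Rf & opnorm2 dX <= c2 * eps * opnorm2 X)
      /\ opnorm2 (1%:M - Q^T *m Q) <= c3 * eps].
Proof.
move=> p_gt0 _ beta_ge0.
have [c1 [c2 [c3 [c1_gt0 c2_gt0 c3_gt0 acc]]]] := @uniform_accuracy R m p beta p_gt0 beta_ge0.
exists c1, c2, c3; split=> // eps X Q Rf e0 alg.
move=> /(kappa_bound (mulr_gt0 c1_gt0 e0))[s0 cond].
have [delayed [chol [S [Y [V [W spec]]]]]] : exists delayed chol S Y V W,
    run_spec beta delayed chol eps X Q Rf S Y V W.
  case: alg => [/(BCGSIA_3S_run beta_ge0 e0)|[/BCGSIA_2S_run|/BCGSIA_1S_run]] h.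
  - by exists false, false.
  - by exists false, true.
  - by exists true, true.
have [|res orth] := acc delayed chol (Run eps X Q Rf S Y V W) spec; first by split.
by split=> //; exists (Q *m Rf - X) => //; rewrite addrC subrK.
Qed.
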